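(* Let $s<0$, let $\omega\in\{+1,-1\}$, and let $p\ge 3$ be an odd integer. There is a constant $c>0$, depending only on $s$, such that the following holds. For every $\rho>0$ there exists a solution $u$ of $$-iu_t+u_{xx}=\omega|u|^{p-1}u$$ on $[0,\infty)\times\mathbb{T}$ with $\|u(0)\|_{H^s(\mathbb{T})}\le\rho$, such that for every $\delta>0$ there exists a solution $\tilde u$ of the same equation on $[0,\delta]\times\mathbb{T}$ satisfying $$\|u(0)-\tilde u(0)\|_{H^s(\mathbb{T})}<\delta$$ and $$\sup_{0\le t\le\delta}\bigl|\widehat{u(t)}(0)-\widehat{\tilde u(t)}(0)\bigr|>c\rho .$$
   Context: $\mathbb{T}=\mathbb{R}/2\pi\mathbb{Z}$. Functions $u(t,x)$ are complex valued, and $u(t)$ denotes the function $x\mapsto u(t,x)$ on $\mathbb{T}$. Solutions are understood as smooth (classical) solutions of the equation on the indicated space-time domain. Fourier coefficients are $\hat f(n)=\frac1{2\pi}\int_{\mathbb{T}}f(x)e^{-inx}\,dx$ for $n\in\mathbb{Z}$, and $\|f\|_{H^s(\mathbb{T})}=\bigl(\sum_{n\in\mathbb{Z}}(1+|n|)^{2s}|\hat f(n)|^2\bigr)^{1/2}$. In particular $\widehat{u(t)}(0)$ is the mean of $u(t)$ over $\mathbb{T}$. *)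

(* Defs.v *)
From Stdlib Require Import Reals ZArith.
From Coquelicot Require Import Coquelicot.

Open Scope R_scope.

Definition expi (a : R) : C := (cos a, sin a).

(* A function on R/(2 PI Z) is represented by its 2 PI-periodic lift to R. *)
Definition fourier (f : R -> C) (n : Z) : C :=
  Cmult (RtoC (/ (2 * PI)))
    (RInt (V := C_R_CompleteNormedModule)
       (fun x => Cmult (f x) (expi (- (IZR n * x)))) 0 (2 * PI)).

(* For nonnegative terms only: the sum over Z, paired as
   (0, -1), (1, -2), (2, -3), ..., with value p_infty if it diverges. *)
Definition Zsum (a : Z -> R) : Rbar :=
  Lim_seq (sum_n (fun k : nat => a (Z.of_nat k) + a (- Z.of_nat (S k))%Z)).

Definition Rbar_sqrt (x : Rbar) : Rbar :=
  match x with
  | Finite r => Finite (sqrt r)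
  | p_infty => p_infty
  | m_infty => Finite 0
  end.

Definition Hs_norm (s : R) (f : R -> C) : Rbar :=
  Rbar_sqrt
    (Zsum (fun n => Rpower (1 + Rabs (IZR n)) (2 * s) * Cmod (fourier f n) ^ 2)).

(* Derivative relative to the set I; one-sided at an endpoint of an interval. *)
Definition is_derive_within (I : R -> Prop) (f : R -> C) (t : R) (l : C) : Prop :=
  filterdiff (U := R_NormedModule) (V := C_R_NormedModule) f
    (within I (locally t)) (fun h : R => scal h (l : C_R_NormedModule)).

(* u is smooth on I x R, up to the endpoints that belong to the interval I,
   and D j k is its partial derivative of order j in t and k in x. *)
Definition smooth_with_partials (I : R -> Prop) (u : R -> R -> C)
    (D : nat -> nat -> R -> R -> C) : Prop :=
  forall t x : R, I t ->
    D 0%nat 0%nat t x = u t x /\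
    forall j k : nat,
      filterlim (fun z : R * R => D j k (fst z) (snd z))
        (within (fun z : R * R => I (fst z)) (locally (t, x)))
        (locally (D j k t x)) /\
      is_derive_within I (fun t' => D j k t' x) t (D (S j) k t x) /\
      is_derive (V := C_R_NormedModule) (fun x' => D j k t x') x (D j (S k) t x).

(* Smooth solutions of  - i u_t + u_xx = omega |u|^(p-1) u  on I x R/(2 PI Z). *)
Definition is_solution (omega : R) (p : nat) (I : R -> Prop) (u : R -> R -> C) : Prop :=
  (forall t x : R, I t -> u t (x + 2 * PI) = u t x) /\
  exists D : nat -> nat -> R -> R -> C,
    smooth_with_partials I u D /\
    forall t x : R, I t ->
      Cplus (Cmult (Copp Ci) (D 1%nat 0%nat t x)) (D 0%nat 2%nat t x)
      = Cmult (RtoC (omega * Cmod (u t x) ^ (p - 1))) (u t x).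

(* Main.v *)
Require Import Defs.
From Stdlib Require Import Reals ZArith Lra Lia.
From Coquelicot Require Import Coquelicot.

Open Scope R_scope.

(* Take u to be the constant plane wave rho e^(i theta0 t), theta0 = omega rho^(p-1), and v an exact
   travelling wave v = e^(i theta t) P(N x + kappa t) with P close to rho + K e^(iy), mean P = rho.
   The high mode K e^(iNx) has tiny H^s norm for large N since s < 0, but it makes the mean of v rotate
   at a rate theta with |theta - theta0| >= PI / delta once K is large; so within time delta the two
   means become opposite, at distance 2 rho.

   With kappa = N^2 - gamma and eps = N^-2, the equation for v is
     P'' - i P' = eps (omega |P|^(p-1) P - theta P - i gamma P').
   The kernel of the left-hand side is spanned by modes 0 and 1; theta and gamma are determined by
   solvability on these two modes, and a contraction argument gives P for small eps. As P is 2 PI-periodic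
   with mean rho and bounded uniformly in N, v(0) - u(0) has frequencies in N Z \ {0}, and Bessel's inequality
   bounds its H^s norm by O((1 + N)^s). *)

(** * Calculus of complex-valued functions of a real variable *)

(** The rotation speeds up because the nonlinearity couples the mean to the high mode: the mean of
    |a + K e^(iy)|^(p-1) (a + K e^(iy)), divided by a, is at least (a^2 + K^2)^((p-1)/2), which
    exceeds a^(p-1) by any prescribed amount for large K. Since K must be large, the amplitude
    cannot be the small parameter; N^-2 is. The drift N^2 is the dispersion relation of the free
    wave e^(i(Nx + N^2 t)). On mode n the operator P'' - i P' acts as n(1 - n), so off its kernel it
    has an inverse bounded independently of N. Solvability on modes 0 and 1 gives two complex
    conditions for two real unknowns theta and gamma. Restricting to profiles with P(-y) = conj P(y)
    makes both conditions real. The unknown of the fixed-point problem is g = P'' - i P' rather than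
    P: both P and P' are recovered from g by integration, so the term in P' costs no derivative and
    the sup norm suffices. The choices are made in the order delta, K, N; the bound on P depends on
    K but not on N, so letting N grow makes the initial distance small without affecting the gap
    between the rates. *)

Definition cont (f : R -> C) : Prop := forall x : R, continuous (U := C_UniformSpace) f x.
Definition deriv_at (f : R -> C) (x : R) (l : C) : Prop :=
  is_derive (V := C_R_NormedModule) f x l.
Definition periodic (f : R -> C) : Prop := forall x : R, f (x + 2 * PI) = f x.
Definition integral (f : R -> C) (a b : R) : C :=
  RInt (V := C_R_CompleteNormedModule) f a b.
Definition mean (f : R -> C) : C := Cmult (RtoC (/ (2 * PI))) (integral f 0 (2 * PI)).

Lemma C_ext (z w : C) : fst z = fst w -> snd z = snd w -> z = w.
Proof. destruct z, w; simpl; intros; subst; reflexivity. Qed.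

Lemma norm_Cmod (z : C) : norm (K := R_AbsRing) (V := C_R_NormedModule) z = Cmod z.
Proof.
  unfold Cmod; change (sqrt (Rabs (fst z) ^ 2 + Rabs (snd z) ^ 2) = sqrt (fst z ^ 2 + snd z ^ 2)).
  now rewrite !pow2_abs.
Qed.

Lemma continuous_C_pair {T : UniformSpace} (f g : T -> R) (x : T) :
  continuous f x -> continuous g x ->
  continuous (U := C_UniformSpace) (fun y => (f y, g y) : C) x.
Proof.
  intros Hf Hg P [eps HP].
  pose proof (Hf _ (locally_ball (f x) eps)) as H1.
  pose proof (Hg _ (locally_ball (g x) eps)) as H2.
  unfold filtermap in *.
  generalize (filter_and _ _ H1 H2). apply filter_imp.
  intros y [? ?]. apply HP. split; assumption.
Qed.

Lemma continuous_Re {T : UniformSpace} (f : T -> C) (x : T) :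
  continuous (U := C_UniformSpace) f x -> continuous (fun y => fst (f y)) x.
Proof.
  intro H. apply (continuous_comp f fst x H). destruct (f x). apply continuous_fst.
Qed.

Lemma continuous_Im {T : UniformSpace} (f : T -> C) (x : T) :
  continuous (U := C_UniformSpace) f x -> continuous (fun y => snd (f y)) x.
Proof.
  intro H. apply (continuous_comp f snd x H). destruct (f x). apply continuous_snd.
Qed.

Lemma continuous_Cplus {T : UniformSpace} (f g : T -> C) (x : T) :
  continuous (U := C_UniformSpace) f x -> continuous (U := C_UniformSpace) g x ->
  continuous (U := C_UniformSpace) (fun y => Cplus (f y) (g y)) x.
Proof.
  intros Hf Hg. unfold Cplus. apply continuous_C_pair.
  - apply (continuous_plus (V := R_NormedModule)); now apply continuous_Re.
  - apply (continuous_plus (V := R_NormedModule)); now apply continuous_Im.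
Qed.

Lemma continuous_Cmult {T : UniformSpace} (f g : T -> C) (x : T) :
  continuous (U := C_UniformSpace) f x -> continuous (U := C_UniformSpace) g x ->
  continuous (U := C_UniformSpace) (fun y => Cmult (f y) (g y)) x.
Proof.
  intros Hf Hg. unfold Cmult. apply continuous_C_pair.
  - apply (continuous_minus (V := R_NormedModule));
      apply (continuous_mult (K := R_AbsRing)); (now apply continuous_Re) || (now apply continuous_Im).
  - apply (continuous_plus (V := R_NormedModule));
      apply (continuous_mult (K := R_AbsRing)); (now apply continuous_Re) || (now apply continuous_Im).
Qed.

Lemma cont_const (c : C) : cont (fun _ => c).
Proof. intro x. apply continuous_const. Qed.

Lemma cont_plus (f g : R -> C) : cont f -> cont g -> cont (fun x => Cplus (f x) (g x)).
Proof. intros Hf Hg x. now apply continuous_Cplus. Qed.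

Lemma cont_mult (f g : R -> C) : cont f -> cont g -> cont (fun x => Cmult (f x) (g x)).
Proof. intros Hf Hg x. now apply continuous_Cmult. Qed.

Lemma cont_ext (f g : R -> C) : (forall x, f x = g x) -> cont f -> cont g.
Proof. intros E H x. now apply (continuous_ext f). Qed.

Lemma cont_conj (f : R -> C) : cont f -> cont (fun x => Cconj (f x)).
Proof.
  intros Hf x. unfold Cconj. apply continuous_C_pair.
  - now apply continuous_Re.
  - apply (continuous_opp (V := R_NormedModule)). now apply continuous_Im.
Qed.

Lemma is_derive_eq {V : NormedModule R_AbsRing} (f g : R -> V) (x : R) (l l' : V) :
  is_derive f x l -> (forall y, f y = g y) -> l = l' -> is_derive g x l'.
Proof. intros H E <-. exact (is_derive_ext _ _ _ _ E H). Qed.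

Lemma deriv_pair (f : R -> C) (x : R) (l : C) :
  is_derive (fun y => fst (f y)) x (fst l) -> is_derive (fun y => snd (f y)) x (snd l) ->
  deriv_at f x l.
Proof.
  intros H1 H2.
  assert (H := is_derive_plus (V := C_R_NormedModule) _ _ _ _ _
    (is_derive_scal_l (V := C_R_NormedModule) _ _ _ ((1, 0) : C) H1)
    (is_derive_scal_l (V := C_R_NormedModule) _ _ _ ((0, 1) : C) H2)).
  unfold deriv_at.
  match type of H with is_derive _ _ ?l' => replace l with (l' : C) end.
  - eapply is_derive_ext; [|exact H]. intro t.
    apply C_ext; simpl; unfold scal; simpl; unfold mult, plus; simpl; ring.
  - apply C_ext; simpl; unfold scal; simpl; unfold mult, plus; simpl; ring.
Qed.

Lemma deriv_Re (f : R -> C) (x : R) (l : C) :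
  deriv_at f x l -> is_derive (fun y => fst (f y)) x (fst l).
Proof.
  intro H.
  exact (filterdiff_comp' (W := R_NormedModule) f fst x (fun y : R => scal y (l : C_R_NormedModule)) fst H
    (filterdiff_linear _ is_linear_fst)).
Qed.

Lemma deriv_Im (f : R -> C) (x : R) (l : C) :
  deriv_at f x l -> is_derive (fun y => snd (f y)) x (snd l).
Proof.
  intro H.
  exact (filterdiff_comp' (W := R_NormedModule) f snd x (fun y : R => scal y (l : C_R_NormedModule)) snd H
    (filterdiff_linear _ is_linear_snd)).
Qed.

Lemma deriv_eq (f g : R -> C) (x : R) (l l' : C) :
  deriv_at f x l -> (forall y, f y = g y) -> l = l' -> deriv_at g x l'.
Proof. exact (is_derive_eq f g x l l'). Qed.

Lemma deriv_const (c : C) (x : R) : deriv_at (fun _ => c) x (RtoC 0).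
Proof. exact (is_derive_const (V := C_R_NormedModule) c x). Qed.

Lemma deriv_plus (f g : R -> C) (x : R) (l k : C) :
  deriv_at f x l -> deriv_at g x k -> deriv_at (fun y => Cplus (f y) (g y)) x (Cplus l k).
Proof. intros Hf Hg. exact (is_derive_plus (V := C_R_NormedModule) f g x l k Hf Hg). Qed.

Lemma deriv_mult (f g : R -> C) (x : R) (l k : C) :
  deriv_at f x l -> deriv_at g x k ->
  deriv_at (fun y => Cmult (f y) (g y)) x (Cplus (Cmult l (g x)) (Cmult (f x) k)).
Proof.
  intros Hf Hg.
  pose proof (deriv_Re _ _ _ Hf) as F1. pose proof (deriv_Im _ _ _ Hf) as F2.
  pose proof (deriv_Re _ _ _ Hg) as G1. pose proof (deriv_Im _ _ _ Hg) as G2.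
  apply deriv_pair.
  - eapply is_derive_eq; [exact (is_derive_minus _ _ _ _ _ (is_derive_mult _ _ _ _ _ F1 G1 Rmult_comm)
      (is_derive_mult _ _ _ _ _ F2 G2 Rmult_comm))|reflexivity|].
    simpl; unfold minus, plus, opp, mult; simpl; ring.
  - eapply is_derive_eq; [exact (is_derive_plus _ _ _ _ _ (is_derive_mult _ _ _ _ _ F1 G2 Rmult_comm)
      (is_derive_mult _ _ _ _ _ F2 G1 Rmult_comm))|reflexivity|].
    simpl; unfold minus, plus, opp, mult; simpl; ring.
Qed.

Lemma deriv_conj (f : R -> C) (x : R) (l : C) :
  deriv_at f x l -> deriv_at (fun y => Cconj (f y)) x (Cconj l).
Proof.
  intro H. apply deriv_pair; simpl.
  - exact (deriv_Re _ _ _ H).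
  - exact (is_derive_opp _ _ _ (deriv_Im _ _ _ H)).
Qed.

Lemma deriv_comp_affine (f : R -> C) (a b x : R) (l : C) :
  deriv_at f (a * x + b) l -> deriv_at (fun y => f (a * y + b)) x (Cmult (RtoC a) l).
Proof.
  intro H.
  assert (H0 : is_derive (fun y : R => a * y + b) x a) by (auto_derive; [trivial|ring]).
  eapply deriv_eq; [exact (is_derive_comp (V := C_R_NormedModule) f _ x l a H H0)|reflexivity|].
  apply C_ext; simpl; unfold scal; simpl; unfold mult; simpl; ring.
Qed.

Lemma deriv_cont (f df : R -> C) : (forall x, deriv_at f x (df x)) -> cont f.
Proof.
  intros H x. apply (ex_derive_continuous (V := C_R_NormedModule) f x).
  exists (df x). apply H.
Qed.

Lemma expi_deriv (a b x : R) :
  deriv_at (fun y => expi (a * y + b)) x (Cmult (Cmult Ci (RtoC a)) (expi (a * x + b))).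
Proof.
  apply deriv_pair; simpl; auto_derive; trivial; ring.
Qed.

Lemma cont_expi (a b : R) : cont (fun y => expi (a * y + b)).
Proof. exact (deriv_cont _ _ (expi_deriv a b)). Qed.

Lemma integral_deriv (F f : R -> C) (a b : R) :
  (forall x, deriv_at F x (f x)) -> cont f -> integral f a b = Cminus (F b) (F a).
Proof.
  intros HF Hf. apply (is_RInt_unique (V := C_R_CompleteNormedModule)).
  apply (is_RInt_derive (V := C_R_CompleteNormedModule) F f); intros; [apply HF|apply Hf].
Qed.

Lemma is_RInt_integral (f : R -> C) (a b : R) :
  cont f -> is_RInt (V := C_R_NormedModule) f a b (integral f a b).
Proof.
  intro Hf. apply (RInt_correct (V := C_R_CompleteNormedModule)).
  apply (ex_RInt_continuous (V := C_R_CompleteNormedModule)). intros z _. apply Hf.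
Qed.

Lemma primitive_deriv (f : R -> C) (a x : R) :
  cont f -> deriv_at (fun y => integral f a y) x (f x).
Proof.
  intro Hf. apply (is_derive_RInt (V := C_R_NormedModule) f _ a).
  - apply filter_forall. intro y. now apply is_RInt_integral.
  - apply Hf.
Qed.

Lemma integral_point (f : R -> C) (a : R) : integral f a a = RtoC 0.
Proof. apply (RInt_point (V := C_R_CompleteNormedModule)). Qed.

(** The integral of the zero function is computed with the two primitives F and 0, and the values
    are compared. Identities between primitives are proved below by differentiating in the endpoint
    and applying this. *)
Lemma deriv_eq_zero (F : R -> C) (a b : R) : (forall x, deriv_at F x (RtoC 0)) -> F b = F a.
Proof.
  intro H. pose proof (integral_deriv F _ a b H (cont_const _)) as E1.
  pose proof (integral_deriv (fun _ => RtoC 0) _ a b (deriv_const _) (cont_const _)) as E2.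
  rewrite E2 in E1.
  replace (F b) with (Cplus (Cminus (F b) (F a)) (F a)) by ring. rewrite <- E1. ring.
Qed.

Lemma integral_ext (f g : R -> C) (a b : R) : (forall x, f x = g x) -> integral f a b = integral g a b.
Proof. intro E. apply (RInt_ext (V := C_R_CompleteNormedModule)). intros; apply E. Qed.

Lemma integral_plus (f g : R -> C) (a b : R) : cont f -> cont g ->
  integral (fun x => Cplus (f x) (g x)) a b = Cplus (integral f a b) (integral g a b).
Proof.
  intros Hf Hg.
  rewrite (integral_deriv (fun y => Cplus (integral f a y) (integral g a y)) _ a b).
  - rewrite !integral_point. ring.
  - intro x. apply deriv_plus; now apply primitive_deriv.
  - now apply cont_plus.
Qed.

Lemma integral_scal (c : C) (f : R -> C) (a b : R) : cont f ->
  integral (fun x => Cmult c (f x)) a b = Cmult c (integral f a b).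
Proof.
  intros Hf.
  rewrite (integral_deriv (fun y => Cmult c (integral f a y)) _ a b).
  - rewrite !integral_point. ring.
  - intro x. eapply deriv_eq; [apply deriv_mult; [apply deriv_const|now apply primitive_deriv]|reflexivity|cbv beta; ring].
  - apply cont_mult; [apply cont_const|assumption].
Qed.

Lemma integral_norm_le (f : R -> C) (a b M : R) : a <= b -> cont f ->
  (forall x, Cmod (f x) <= M) -> Cmod (integral f a b) <= (b - a) * M.
Proof.
  intros Hab Hf HM. rewrite <- norm_Cmod.
  apply (norm_RInt_le_const (V := C_R_NormedModule) f a b _ M Hab).
  - intros x _. rewrite norm_Cmod. apply HM.
  - now apply is_RInt_integral.
Qed.

Lemma primitive_periodic (f : R -> C) (y : R) : cont f -> periodic f ->
  integral f 0 (y + 2 * PI) = Cplus (integral f 0 y) (integral f 0 (2 * PI)).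
Proof.
  intros Hf Hp.
  assert (E := deriv_eq_zero (fun y => Cplus (integral f 0 (1 * y + 2 * PI))
    (Cmult (RtoC (-1)) (integral f 0 y))) 0 y).
  assert (H : forall x, deriv_at (fun y => Cplus (integral f 0 (1 * y + 2 * PI))
    (Cmult (RtoC (-1)) (integral f 0 y))) x (RtoC 0)).
  { intro x. eapply deriv_eq; [apply deriv_plus; [apply (deriv_comp_affine (integral f 0));
      now apply primitive_deriv|apply deriv_mult; [apply deriv_const|now apply primitive_deriv]]|reflexivity|].
    replace (1 * x + 2 * PI) with (x + 2 * PI) by ring. rewrite Hp. ring. }
  specialize (E H). cbv beta in E.
  rewrite integral_point in E. replace (1 * 0 + 2 * PI) with (2 * PI) in E by ring.
  replace (1 * y + 2 * PI) with (y + 2 * PI) in E by ring.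
  transitivity (Cplus (Cplus (integral f 0 (y + 2 * PI)) (Cmult (RtoC (-1)) (integral f 0 y))) (integral f 0 y)).
  - ring.
  - rewrite E. ring.
Qed.

Lemma periodic_Z {T} (f : R -> T) : (forall x, f (x + 2 * PI) = f x) ->
  forall (k : Z) (x : R), f (x + IZR k * (2 * PI)) = f x.
Proof.
  intros Hp.
  assert (N : forall (k : nat) x, f (x + INR k * (2 * PI)) = f x).
  { induction k as [|k IH]; intro x.
    - simpl. f_equal. ring.
    - rewrite S_INR. replace (x + (INR k + 1) * (2 * PI)) with (x + INR k * (2 * PI) + 2 * PI) by ring.
      now rewrite Hp. }
  intros k x. destruct k as [|k|k].
  - f_equal. simpl. ring.
  - change (IZR (Z.pos k)) with (IPR k). rewrite <- INR_IPR. apply N.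
  - change (IZR (Z.neg k)) with (- IPR k). rewrite <- INR_IPR.
    rewrite <- (N (Pos.to_nat k) (x + _)). f_equal. ring.
Qed.

Lemma periodic_reduce (x : R) : exists k : Z, 0 <= x + IZR k * (2 * PI) <= 2 * PI.
Proof.
  pose proof PI_RGT_0 as Hpi.
  exists (1 - up (x / (2 * PI)))%Z. rewrite minus_IZR.
  destruct (archimed (x / (2 * PI))) as [H1 H2].
  set (u := IZR (up (x / (2 * PI)))) in *.
  assert (E : x = x / (2 * PI) * (2 * PI)) by (field; lra).
  set (q := x / (2 * PI)) in *. rewrite E. split; nra.
Qed.

(** Zero integral over a period makes the primitive itself periodic, so y can be moved into
    [0, 2 PI]; this gives a bound uniform in y. *)
Lemma primitive_bound (f : R -> C) (M y : R) : cont f -> periodic f ->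
  integral f 0 (2 * PI) = RtoC 0 -> (forall x, Cmod (f x) <= M) ->
  Cmod (integral f 0 y) <= 2 * PI * M.
Proof.
  intros Hf Hp H0 HM.
  assert (Hper : forall x, integral f 0 (x + 2 * PI) = integral f 0 x).
  { intro x. rewrite primitive_periodic by assumption. rewrite H0. ring. }
  destruct (periodic_reduce y) as [k [K1 K2]].
  rewrite <- (periodic_Z _ Hper k y).
  eapply Rle_trans; [apply integral_norm_le with (M := M); assumption|].
  assert (0 <= M) by (eapply Rle_trans; [apply Cmod_ge_0|apply (HM 0)]). nra.
Qed.

(** A primitive is F(n x + b) / n, and n x + b runs through n full periods, each contributing the
    same amount. Hence a travelling wave has the mean of its profile at every time. *)
Lemma integral_comp_affine (f : R -> C) (n : nat) (b : R) : (0 < n)%nat -> cont f -> periodic f ->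
  integral (fun x => f (INR n * x + b)) 0 (2 * PI) = integral f 0 (2 * PI).
Proof.
  intros Hn Hf Hp.
  assert (Hn' : INR n <> 0) by (apply not_0_INR; lia).
  assert (HC : RtoC (INR n) <> RtoC 0) by (intro E; apply Hn'; now injection E).
  rewrite (integral_deriv (fun y => Cmult (RtoC (/ INR n)) (integral f 0 (INR n * y + b)))).
  - assert (E : forall k, integral f 0 (INR k * (2 * PI) + b) =
      Cplus (integral f 0 b) (Cmult (RtoC (INR k)) (integral f 0 (2 * PI)))).
    { induction k as [|k IH].
      - simpl INR. replace (0 * (2 * PI) + b) with b by ring. ring.
      - rewrite S_INR. replace ((INR k + 1) * (2 * PI) + b) with (INR k * (2 * PI) + b + 2 * PI) by ring.
        rewrite primitive_periodic by assumption. rewrite IH, RtoC_plus. ring. }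
    rewrite E. replace (INR n * 0 + b) with b by ring. rewrite RtoC_inv by assumption. field. exact HC.
  - intro x. eapply deriv_eq.
    + apply deriv_mult; [apply deriv_const|].
      apply (deriv_comp_affine (integral f 0)). now apply primitive_deriv.
    + reflexivity.
    + cbv beta. rewrite RtoC_inv by assumption. field. exact HC.
  - intro x. apply (continuous_comp (fun x => INR n * x + b) f).
    + apply (ex_derive_continuous (fun x : R => INR n * x + b)). auto_derive. trivial.
    + apply Hf.
Qed.

(* Equivalently, real Fourier coefficients; this symmetry makes the phase rate and the drift below real. *)
Definition hermitian (f : R -> C) : Prop := forall x : R, f (- x) = Cconj (f x).

Lemma primitive_hermitian (f : R -> C) (y : R) : cont f -> hermitian f ->
  integral f 0 (- y) = Copp (Cconj (integral f 0 y)).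
Proof.
  intros Hf Hs.
  assert (E := deriv_eq_zero (fun y => Cplus (integral f 0 (-1 * y + 0))
    (Cconj (integral f 0 y))) 0 y).
  assert (H : forall x, deriv_at (fun y => Cplus (integral f 0 (-1 * y + 0))
    (Cconj (integral f 0 y))) x (RtoC 0)).
  { intro x. eapply deriv_eq; [apply deriv_plus; [apply (deriv_comp_affine (integral f 0));
      now apply primitive_deriv|apply deriv_conj; now apply primitive_deriv]|reflexivity|].
    replace (-1 * x + 0) with (- x) by ring. rewrite Hs. ring. }
  specialize (E H). cbv beta in E.
  replace (-1 * 0 + 0) with 0 in E by ring. rewrite !integral_point in E.
  replace (-1 * y + 0) with (- y) in E by ring.
  transitivity (Cminus (Cplus (integral f 0 (- y)) (Cconj (integral f 0 y))) (Cconj (integral f 0 y))).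
  - ring.
  - rewrite E. apply C_ext; simpl; ring.
Qed.

(** For the primitive F vanishing at 0, periodicity gives 0 = F(-2 PI) + F(2 PI) and the symmetry
    gives F(-2 PI) = - conj F(2 PI), so F(2 PI) is real. *)
Lemma mean_hermitian (f : R -> C) : cont f -> periodic f -> hermitian f -> Cconj (mean f) = mean f.
Proof.
  intros Hf Hp Hs. unfold mean.
  pose proof (primitive_periodic f (- (2 * PI)) Hf Hp) as E.
  rewrite primitive_hermitian in E by assumption.
  replace (- (2 * PI) + 2 * PI) with 0 in E by ring. rewrite integral_point in E.
  set (z := integral f 0 (2 * PI)) in *.
  clearbody z. assert (E2 : snd z = 0) by (apply (f_equal snd) in E; simpl in E; lra).
  apply C_ext; simpl; rewrite E2; ring.
Qed.

(** * Means over a period and contractions *)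

Lemma Cmod_opp_sub (z w : C) : Cmod (Cminus z w) = Cmod (Cminus w z).
Proof. rewrite <- Cmod_opp. f_equal. ring. Qed.

Lemma Cmod_sub_triangle (x y z : C) : Cmod (Cminus x z) <= Cmod (Cminus x y) + Cmod (Cminus y z).
Proof. replace (Cminus x z) with (Cplus (Cminus x y) (Cminus y z)) by ring. apply Cmod_triangle. Qed.

Lemma Cmod_sub_small (z w : C) : (forall eps, 0 < eps -> Cmod (Cminus z w) <= eps) -> z = w.
Proof.
  intro H. assert (E : Cmod (Cminus z w) = 0).
  { apply Rle_antisym; [|apply Cmod_ge_0].
    apply Rnot_lt_le. intro Hlt. specialize (H (Cmod (Cminus z w) / 2) ltac:(lra)). lra. }
  apply Cmod_eq_0 in E.
  replace z with (Cplus (Cminus z w) w) by ring. rewrite E. ring.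
Qed.

Lemma Cmod_le_sum (z : C) : Cmod z <= Rabs (fst z) + Rabs (snd z).
Proof.
  destruct z as [x y]. simpl fst; simpl snd.
  replace ((x, y) : C) with (Cplus (RtoC x) (Cmult Ci (RtoC y))) by (apply C_ext; simpl; ring).
  eapply Rle_trans; [apply Cmod_triangle|].
  rewrite Cmod_mult, !Cmod_R, Cmod_Ci. lra.
Qed.

Lemma Re_sub_le (a b : C) : Rabs (fst a - fst b) <= Cmod (Cminus a b).
Proof.
  pose proof (Rmax_Cmod (Cminus a b)).
  pose proof (Rmax_l (Rabs (fst (Cminus a b))) (Rabs (snd (Cminus a b)))).
  simpl in *. unfold Rminus. lra.
Qed.

Lemma Im_sub_le (a b : C) : Rabs (snd a - snd b) <= Cmod (Cminus a b).
Proof.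
  pose proof (Rmax_Cmod (Cminus a b)).
  pose proof (Rmax_r (Rabs (fst (Cminus a b))) (Rabs (snd (Cminus a b)))).
  simpl in *. unfold Rminus. lra.
Qed.

Lemma Cmod_expi (a : R) : Cmod (expi a) = 1.
Proof.
  transitivity (sqrt 1); [|apply sqrt_1]. unfold Cmod, expi; simpl. f_equal.
  pose proof (sin2_cos2 a). unfold Rsqr in *. lra.
Qed.

Lemma expi_plus (a b : R) : expi (a + b) = Cmult (expi a) (expi b).
Proof. unfold expi. rewrite cos_plus, sin_plus. apply C_ext; simpl; ring. Qed.

Lemma expi_0 : expi 0 = RtoC 1.
Proof. unfold expi. rewrite cos_0, sin_0. reflexivity. Qed.

Lemma expi_neg (a : R) : expi (- a) = Cconj (expi a).
Proof. unfold expi. rewrite cos_neg, sin_neg. reflexivity. Qed.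

Lemma expi_periodic (n : Z) (x : R) : expi (IZR n * (x + 2 * PI)) = expi (IZR n * x).
Proof.
  rewrite Rmult_plus_distr_l. apply (periodic_Z expi); intro y.
  unfold expi. now rewrite cos_plus, sin_plus, cos_2PI, sin_2PI, !Rmult_1_r, !Rmult_0_r, Rminus_0_r, Rplus_0_r.
Qed.

Lemma cont_expi_lin (a : R) : cont (fun x => expi (a * x)).
Proof. refine (cont_ext _ _ _ (cont_expi a 0)). intro x. now rewrite Rplus_0_r. Qed.

Lemma deriv_expi_lin (a x : R) :
  deriv_at (fun y => expi (a * y)) x (Cmult (Cmult Ci (RtoC a)) (expi (a * x))).
Proof.
  refine (deriv_eq _ _ _ _ _ (expi_deriv a 0 x) _ _); [intro y|]; now rewrite Rplus_0_r.
Qed.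

Lemma mean_ext (f g : R -> C) : (forall x, f x = g x) -> mean f = mean g.
Proof. intro E. unfold mean. now rewrite (integral_ext f g). Qed.

Lemma mean_plus (f g : R -> C) : cont f -> cont g ->
  mean (fun x => Cplus (f x) (g x)) = Cplus (mean f) (mean g).
Proof. intros. unfold mean. rewrite integral_plus by assumption. ring. Qed.

Lemma mean_scal (c : C) (f : R -> C) : cont f -> mean (fun x => Cmult c (f x)) = Cmult c (mean f).
Proof. intros. unfold mean. rewrite integral_scal by assumption. ring. Qed.

Lemma mean_deriv (F f : R -> C) : (forall x, deriv_at F x (f x)) -> cont f -> periodic F -> mean f = RtoC 0.
Proof.
  intros HF Hf Hp. unfold mean. rewrite (integral_deriv F f) by assumption.
  rewrite <- (Rplus_0_l (2 * PI)), Hp. ring.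
Qed.

Lemma mean_const (c : C) : mean (fun _ => c) = c.
Proof.
  unfold mean. pose proof PI_RGT_0.
  rewrite (integral_deriv (fun x => Cmult c (RtoC x))).
  - apply C_ext; simpl; field; lra.
  - intro x. apply deriv_pair; simpl; auto_derive; trivial; ring.
  - apply cont_const.
Qed.

Lemma mean_norm_le (f : R -> C) (M : R) : cont f -> (forall x, Cmod (f x) <= M) -> Cmod (mean f) <= M.
Proof.
  intros Hf HM. pose proof PI_RGT_0. unfold mean.
  rewrite Cmod_mult, Cmod_R, Rabs_pos_eq by (left; apply Rinv_0_lt_compat; lra).
  pose proof (integral_norm_le f 0 (2 * PI) M ltac:(lra) Hf HM) as B.
  apply Rmult_le_reg_l with (2 * PI); [lra|]. rewrite <- Rmult_assoc, Rinv_r by lra. lra.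
Qed.

Lemma mean_minus (f g : R -> C) : cont f -> cont g ->
  mean (fun x => Cminus (f x) (g x)) = Cminus (mean f) (mean g).
Proof.
  intros Hf Hg.
  rewrite (mean_ext _ (fun x => Cplus (f x) (Cmult (RtoC (-1)) (g x)))) by (intro; ring).
  rewrite mean_plus, mean_scal; [ring|assumption|assumption|].
  apply cont_mult; [apply cont_const|assumption].
Qed.

Lemma cont_minus (f g : R -> C) : cont f -> cont g -> cont (fun x => Cminus (f x) (g x)).
Proof.
  intros Hf Hg. refine (cont_ext (fun x => Cplus (f x) (Cmult (RtoC (-1)) (g x))) _ _ _); [intro; ring|].
  apply cont_plus; [assumption|]. apply cont_mult; [apply cont_const|assumption].
Qed.

Lemma mean_dist (f g : R -> C) (d : R) : cont f -> cont g ->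
  (forall x, Cmod (Cminus (f x) (g x)) <= d) -> Cmod (Cminus (mean f) (mean g)) <= d.
Proof.
  intros Hf Hg H. rewrite <- mean_minus by assumption.
  apply mean_norm_le; [now apply cont_minus|assumption].
Qed.

Lemma cont_uniform_limit (fn : nat -> R -> C) (f : R -> C) :
  (forall n, cont (fn n)) ->
  (forall eps, 0 < eps -> exists n, forall x, Cmod (Cminus (fn n x) (f x)) <= eps) -> cont f.
Proof.
  intros Hc Hu x. apply filterlim_locally. intro eps.
  destruct (Hu (eps / 3)) as [n Hn]; [apply Rdiv_lt_0_compat; [apply cond_pos|lra]|].
  assert (He : 0 < eps / 3) by (apply Rdiv_lt_0_compat; [apply cond_pos|lra]).
  pose proof (proj1 (filterlim_locally _ _) (Hc n x) (mkposreal _ He)) as H.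
  revert H. apply filter_imp. intros y [H1 H2].
  change (Rabs (fst (fn n y) - fst (fn n x)) < eps / 3) in H1.
  change (Rabs (snd (fn n y) - snd (fn n x)) < eps / 3) in H2.
  pose proof (Hn x) as Nx. pose proof (Hn y) as Ny.
  pose proof (Re_sub_le (fn n x) (f x)). pose proof (Im_sub_le (fn n x) (f x)).
  pose proof (Re_sub_le (fn n y) (f y)). pose proof (Im_sub_le (fn n y) (f y)).
  assert (X1 : Rabs (fst (fn n x) - fst (f x)) <= eps / 3) by lra.
  assert (X2 : Rabs (snd (fn n x) - snd (f x)) <= eps / 3) by lra.
  assert (Y1 : Rabs (fst (fn n y) - fst (f y)) <= eps / 3) by lra.
  assert (Y2 : Rabs (snd (fn n y) - snd (f y)) <= eps / 3) by lra.
  split; [change (Rabs (fst (f y) - fst (f x)) < eps)|change (Rabs (snd (f y) - snd (f x)) < eps)].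
  - apply Rabs_def2 in H1. apply Rabs_le_between in X1. apply Rabs_le_between in Y1. apply Rabs_def1; lra.
  - apply Rabs_def2 in H2. apply Rabs_le_between in X2. apply Rabs_le_between in Y2. apply Rabs_def1; lra.
Qed.

(** The Banach fixed point theorem for the sup distance. Distances enter only through pointwise
    bounds d, so no normed space of functions has to be built; the last hypothesis says that [S] is
    closed under uniform limits. *)
Lemma contraction_fixed_point {X : Type} (S : (X -> C) -> Prop) (T : (X -> C) -> X -> C) (g0 : X -> C) :
  S g0 -> (forall g, S g -> S (T g)) -> (forall g, S g -> forall y, Cmod (g y) <= 1) ->
  (forall g1 g2 d, S g1 -> S g2 -> (forall y, Cmod (Cminus (g1 y) (g2 y)) <= d) ->
     forall y, Cmod (Cminus (T g1 y) (T g2 y)) <= d / 2) ->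
  (forall (gn : nat -> X -> C) g, (forall n, S (gn n)) ->
     (forall eps, 0 < eps -> exists n, forall y, Cmod (Cminus (gn n y) (g y)) <= eps) -> S g) ->
  exists g, S g /\ forall y, T g y = g y.
Proof.
  intros S0 ST SB SC SL.
  set (gn := fun n => Nat.iter n T g0).
  assert (Sn : forall n, S (gn n)) by (induction n; [exact S0|apply ST; assumption]).
  (* Members of [S] lie in the unit ball, hence within 2 of each other, and each application of [T]
     halves distances. *)
  set (e := fun n => 2 * (/ 2) ^ n).
  assert (He : forall eps, 0 < eps -> exists n, forall m, (n <= m)%nat -> e m < eps).
  { intros eps Heps. destruct (pow_lt_1_zero (/ 2) ltac:(rewrite Rabs_pos_eq; lra) (eps / 2) ltac:(lra)) as [n Hn].
    exists n. intros m Hm. specialize (Hn m Hm).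
    unfold e. apply Rabs_def2 in Hn. lra. }
  assert (HC : forall n k y, Cmod (Cminus (gn (n + k)%nat y) (gn n y)) <= e n).
  { induction n as [|n IH]; intros k y.
    - unfold e. simpl. eapply Rle_trans; [apply Cmod_triangle|]. rewrite Cmod_opp.
      pose proof (SB _ (Sn k) y). pose proof (SB _ S0 y). lra.
    - replace (e (Datatypes.S n)) with (e n / 2) by (unfold e; simpl; field).
      apply (SC (gn (n + k)%nat) (gn n)); auto. }
  assert (HL : forall y (pr : C -> R), (forall a b, Rabs (pr a - pr b) <= Cmod (Cminus a b)) ->
    exists l, forall n, Rabs (pr (gn n y) - l) <= e n).
  { intros y pr Hpr.
    assert (Hcv : ex_finite_lim_seq (fun n => pr (gn n y))).
    { apply ex_lim_seq_cauchy_corr. intro eps.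
      destruct (He (eps / 2)) as [N HN]; [apply Rdiv_lt_0_compat; [apply cond_pos|lra]|].
      exists N. intros n m Hn Hm.
      eapply Rle_lt_trans; [apply Hpr|].
      eapply Rle_lt_trans; [apply (Cmod_sub_triangle _ (gn N y))|].
      replace n with (N + (n - N))%nat by lia. replace m with (N + (m - N))%nat by lia.
      pose proof (HC N (n - N)%nat y). pose proof (HC N (m - N)%nat y) as Hm'.
      rewrite Cmod_opp_sub in Hm'. pose proof (HN N (Nat.le_refl N)). lra. }
    destruct Hcv as [l Hl]. exists l. intro n.
    assert (Hd : is_lim_seq (fun k => Rabs (pr (gn n y) - pr (gn (k + n)%nat y))) (Rabs (pr (gn n y) - l))).
    { apply (is_lim_seq_abs _ (Finite _)). apply is_lim_seq_minus'; [apply is_lim_seq_const|].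
      now apply -> (is_lim_seq_incr_n (fun k => pr (gn k y)) n). }
    refine (is_lim_seq_le _ _ (Finite _) (Finite _) _ Hd (is_lim_seq_const (e n))).
    intro k. eapply Rle_trans; [apply Hpr|]. rewrite Cmod_opp_sub, Nat.add_comm. apply HC. }
  assert (HL2 : forall y, exists l : C, forall n, Cmod (Cminus (gn n y) l) <= 2 * e n).
  { intro y. destruct (HL y fst) as [l1 H1].
    { exact Re_sub_le. }
    destruct (HL y snd) as [l2 H2].
    { exact Im_sub_le. }
    exists (l1, l2). intro n. eapply Rle_trans; [apply Cmod_le_sum|].
    specialize (H1 n). specialize (H2 n). unfold Rminus in *. simpl. lra. }
  (* The limit is given by a formula, so no choice principle is needed to pass from pointwise limits
     to a function. The errors of the real and imaginary parts add up, whence the bound 2 *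
     [e n]. *)
  set (g := fun y => (real (Lim_seq (fun n => fst (gn n y))), real (Lim_seq (fun n => snd (gn n y)))) : C).
  assert (Hg : forall n y, Cmod (Cminus (gn n y) (g y)) <= 2 * e n).
  { intros n y. destruct (HL2 y) as [l Hl]. replace (g y) with l; [apply Hl|].
    assert (Hpr : forall pr : C -> R, (forall a b, Rabs (pr a - pr b) <= Cmod (Cminus a b)) ->
       real (Lim_seq (fun n => pr (gn n y))) = pr l).
    { intros pr Hpr. rewrite (is_lim_seq_unique _ (Finite (pr l))); [reflexivity|].
      apply is_lim_seq_spec. intro eps. destruct (He (eps / 2)) as [N HN]; [apply Rdiv_lt_0_compat; [apply cond_pos|lra]|].
      exists N. intros k Hk. eapply Rle_lt_trans; [apply Hpr|].
      specialize (HN k Hk). specialize (Hl k). lra. }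
    unfold g. rewrite (Hpr fst), (Hpr snd); [now destruct l|exact Im_sub_le|exact Re_sub_le]. }
  assert (Sg : S g).
  { apply (SL gn); [assumption|]. intros eps Heps. destruct (He (eps / 2)) as [N HN]; [lra|].
    exists N. intro y. specialize (Hg N y). specialize (HN N (Nat.le_refl N)). lra. }
  exists g. split; [assumption|]. intro y. apply Cmod_sub_small. intros eps Heps.
  destruct (He (eps / 3)) as [N HN]; [lra|]. specialize (HN N (Nat.le_refl N)).
  eapply Rle_trans; [apply (Cmod_sub_triangle _ (gn (Datatypes.S N) y))|].
  pose proof (Hg (Datatypes.S N) y) as H1.
  replace (e (Datatypes.S N)) with (e N / 2) in H1 by (unfold e; simpl; field).
  assert (H2 : Cmod (Cminus (T (gn N) y) (T g y)) <= (2 * e N) / 2) by (apply SC; auto).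
  rewrite Cmod_opp_sub in H2. change (gn (Datatypes.S N)) with (T (gn N)) in *. lra.
Qed.

(** * Functionals on the ball of admissible functions *)

Definition wave (n : Z) (y : R) : C := expi (IZR n * y).

Definition regular (f : R -> C) : Prop := cont f /\ periodic f /\ hermitian f.

Lemma wave_regular (n : Z) : regular (wave n).
Proof.
  split; [apply cont_expi_lin|split].
  - intro x. apply expi_periodic.
  - intro x. unfold wave. rewrite <- expi_neg. f_equal. ring.
Qed.

Lemma wave_deriv (n : Z) (x : R) : deriv_at (wave n) x (Cmult (Cmult Ci (RtoC (IZR n))) (wave n x)).
Proof. apply deriv_expi_lin. Qed.

Lemma Cmod_wave (n : Z) (x : R) : Cmod (wave n x) = 1.
Proof. apply Cmod_expi. Qed.

Lemma wave_mul (j k : Z) (x : R) : Cmult (wave j x) (wave k x) = wave (j + k) x.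
Proof. unfold wave. rewrite <- expi_plus, plus_IZR. f_equal. ring. Qed.

Lemma wave_0 (x : R) : wave 0 x = RtoC 1.
Proof. unfold wave. rewrite Rmult_0_l. apply expi_0. Qed.

Lemma regular_plus (f g : R -> C) : regular f -> regular g -> regular (fun y => Cplus (f y) (g y)).
Proof.
  intros [F1 [F2 F3]] [G1 [G2 G3]]. split; [now apply cont_plus|split]; intro x.
  - now rewrite F2, G2.
  - rewrite F3, G3. apply C_ext; simpl; ring.
Qed.

Lemma regular_mult (f g : R -> C) : regular f -> regular g -> regular (fun y => Cmult (f y) (g y)).
Proof.
  intros [F1 [F2 F3]] [G1 [G2 G3]]. split; [now apply cont_mult|split]; intro x.
  - now rewrite F2, G2.
  - rewrite F3, G3. apply C_ext; simpl; ring.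
Qed.

Lemma regular_conj (f : R -> C) : regular f -> regular (fun y => Cconj (f y)).
Proof.
  intros [F1 [F2 F3]]. split; [now apply cont_conj|split]; intro x.
  - now rewrite F2.
  - now rewrite F3.
Qed.

Lemma regular_const (c : C) : Cconj c = c -> regular (fun _ => c).
Proof. intro H. split; [apply cont_const|split]; intro x; [reflexivity|now symmetry]. Qed.

Lemma Cconj_RtoC (r : R) : Cconj (RtoC r) = RtoC r.
Proof. apply C_ext; simpl; ring. Qed.

Lemma regular_mean (f : R -> C) : regular f -> regular (fun _ => mean f).
Proof. intros [F1 [F2 F3]]. apply regular_const. now apply mean_hermitian. Qed.

(** The factor i preserves the hermitian symmetry: the primitive F of a hermitian function satisfies
    F(-y) = - conj F(y), and i F is hermitian again. The mean is subtracted so that modes 0 and 1 of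
    the profile can be prescribed. *)
Definition primitive0 (h : R -> C) (y : R) : C :=
  Cminus (Cmult Ci (integral h 0 y)) (mean (fun z => Cmult Ci (integral h 0 z))).

Lemma primitive_cont (h : R -> C) : cont h -> cont (fun z => Cmult Ci (integral h 0 z)).
Proof.
  intro H. apply cont_mult; [apply cont_const|].
  apply (deriv_cont _ h). intro x. now apply primitive_deriv.
Qed.

Lemma mean_zero_integral (h : R -> C) : mean h = RtoC 0 -> integral h 0 (2 * PI) = RtoC 0.
Proof.
  unfold mean. intro H. pose proof PI_RGT_0.
  replace (integral h 0 (2 * PI)) with
    (Cmult (RtoC (2 * PI)) (Cmult (RtoC (/ (2 * PI))) (integral h 0 (2 * PI)))).
  - rewrite H. ring.
  - rewrite Cmult_assoc, <- RtoC_mult, Rinv_r by lra. ring.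
Qed.

Lemma primitive0_deriv (h : R -> C) (x : R) : cont h -> deriv_at (primitive0 h) x (Cmult Ci (h x)).
Proof.
  intro H. unfold primitive0.
  eapply deriv_eq; [apply deriv_plus; [apply deriv_mult; [apply deriv_const|now apply primitive_deriv]|
    apply deriv_const]|reflexivity|cbv beta; ring].
Qed.

Lemma primitive0_mean (h : R -> C) : cont h -> mean (primitive0 h) = RtoC 0.
Proof.
  intro H. unfold primitive0.
  rewrite mean_minus; [rewrite mean_const; ring|now apply primitive_cont|apply cont_const].
Qed.

Lemma primitive0_regular (h : R -> C) : regular h -> mean h = RtoC 0 -> regular (primitive0 h).
Proof.
  intros [H1 [H2 H3]] H0.
  assert (HU : regular (fun z => Cmult Ci (integral h 0 z))).
  { split; [now apply primitive_cont|split]; intro x.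
    - rewrite primitive_periodic, mean_zero_integral by assumption. ring.
    - rewrite primitive_hermitian by assumption. apply C_ext; simpl; ring. }
  unfold primitive0, Cminus. apply regular_plus; [assumption|].
  apply regular_const. destruct HU as [U1 [U2 U3]].
  rewrite <- (mean_hermitian _ U1 U2 U3) at 2. apply C_ext; simpl; ring.
Qed.

(** The primitive and its mean contribute 2 PI M each. *)
Lemma primitive0_bound (h : R -> C) (M y : R) : cont h -> periodic h -> mean h = RtoC 0 ->
  (forall x, Cmod (h x) <= M) -> Cmod (primitive0 h y) <= 4 * PI * M.
Proof.
  intros H1 H2 H0 HM.
  assert (B : forall x, Cmod (Cmult Ci (integral h 0 x)) <= 2 * PI * M).
  { intro x. rewrite Cmod_mult, Cmod_Ci, Rmult_1_l.
    apply primitive_bound; try assumption. now apply mean_zero_integral. }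
  unfold primitive0. eapply Rle_trans; [apply Cmod_triangle|]. rewrite Cmod_opp.
  pose proof (B y). pose proof (mean_norm_le _ _ (primitive_cont h H1) B). lra.
Qed.

Lemma primitive0_lip (h1 h2 : R -> C) (d y : R) : cont h1 -> periodic h1 -> mean h1 = RtoC 0 ->
  cont h2 -> periodic h2 -> mean h2 = RtoC 0 -> (forall x, Cmod (Cminus (h1 x) (h2 x)) <= d) ->
  Cmod (Cminus (primitive0 h1 y) (primitive0 h2 y)) <= 4 * PI * d.
Proof.
  intros A1 A2 A3 B1 B2 B3 Hd.
  replace (Cminus (primitive0 h1 y) (primitive0 h2 y)) with
    (primitive0 (fun x => Cminus (h1 x) (h2 x)) y).
  - apply primitive0_bound; [now apply cont_minus| |rewrite mean_minus by assumption; rewrite A3, B3; ring|assumption].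
    intro x. now rewrite A2, B2.
  - assert (E : forall z, integral (fun x => Cminus (h1 x) (h2 x)) 0 z = Cminus (integral h1 0 z) (integral h2 0 z)).
    { intro z. rewrite (integral_ext _ (fun x => Cplus (h1 x) (Cmult (RtoC (-1)) (h2 x)))) by (intro; ring).
      rewrite integral_plus, integral_scal; [ring|assumption|assumption|].
      apply cont_mult; [apply cont_const|assumption]. }
    unfold primitive0. rewrite E.
    rewrite (mean_ext (fun z => Cmult Ci (integral (fun x => Cminus (h1 x) (h2 x)) 0 z))
      (fun z => Cminus (Cmult Ci (integral h1 0 z)) (Cmult Ci (integral h2 0 z)))) by (intro; rewrite E; ring).
    rewrite mean_minus by now apply primitive_cont. ring.
Qed.

(* The domain of the contraction: the unknown is the correction g = P'' - i P', which must have
   no modes 0 and 1. *)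
Definition admissible (g : R -> C) : Prop :=
  regular g /\ (forall y, Cmod (g y) <= 1) /\ mean g = RtoC 0 /\
  mean (fun y => Cmult (wave (-1) y) (g y)) = RtoC 0.

(** Bounded and Lipschitz in the sup norm on the admissible set, with values in hermitian periodic
    functions. The class is closed under sums, products, conjugation and means, so the constants for
    the residual are obtained by following its formula; eps and N do not occur in them. *)
Definition tame (Phi : (R -> C) -> R -> C) : Prop :=
  (forall g, admissible g -> regular (Phi g)) /\
  (exists M, 0 <= M /\ forall g y, admissible g -> Cmod (Phi g y) <= M) /\
  (exists L, 0 <= L /\ forall g1 g2 d, admissible g1 -> admissible g2 ->
     (forall y, Cmod (Cminus (g1 y) (g2 y)) <= d) ->
     forall y, Cmod (Cminus (Phi g1 y) (Phi g2 y)) <= L * d).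

Lemma dist_nonneg (g1 g2 : R -> C) (d : R) :
  (forall y, Cmod (Cminus (g1 y) (g2 y)) <= d) -> 0 <= d.
Proof. intro H. eapply Rle_trans; [apply Cmod_ge_0|apply (H 0)]. Qed.

Lemma tame_fixed (f : R -> C) (M : R) : regular f -> (forall y, Cmod (f y) <= M) -> tame (fun _ => f).
Proof.
  intros Hf HM. split; [auto|split].
  - exists M. split; [eapply Rle_trans; [apply Cmod_ge_0|apply (HM 0)]|auto].
  - exists 0. split; [lra|]. intros g1 g2 d _ _ H y. replace (Cminus (f y) (f y)) with (RtoC 0) by ring.
    rewrite Cmod_0. lra.
Qed.

Lemma tame_real (r : R) : tame (fun _ _ => RtoC r).
Proof.
  apply (tame_fixed _ (Rabs r)); [apply regular_const, Cconj_RtoC|].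
  intros _. rewrite Cmod_R. apply Rle_refl.
Qed.

Lemma tame_wave (n : Z) : tame (fun _ => wave n).
Proof. apply (tame_fixed _ 1); [apply wave_regular|]. intro y. rewrite Cmod_wave. apply Rle_refl. Qed.

Lemma tame_plus (Phi Psi : (R -> C) -> R -> C) :
  tame Phi -> tame Psi -> tame (fun g y => Cplus (Phi g y) (Psi g y)).
Proof.
  intros [R1 [[M1 [M1p B1]] [L1 [L1p H1]]]] [R2 [[M2 [M2p B2]] [L2 [L2p H2]]]].
  split; [intros; apply regular_plus; auto|split].
  - exists (M1 + M2). split; [lra|]. intros g y Hg. eapply Rle_trans; [apply Cmod_triangle|].
    apply Rplus_le_compat; auto.
  - exists (L1 + L2). split; [lra|]. intros g1 g2 d A1 A2 Hd y.
    replace (Cminus (Cplus (Phi g1 y) (Psi g1 y)) (Cplus (Phi g2 y) (Psi g2 y))) with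
      (Cplus (Cminus (Phi g1 y) (Phi g2 y)) (Cminus (Psi g1 y) (Psi g2 y))) by ring.
    eapply Rle_trans; [apply Cmod_triangle|]. rewrite Rmult_plus_distr_r.
    apply Rplus_le_compat; auto.
Qed.

Lemma tame_mult (Phi Psi : (R -> C) -> R -> C) :
  tame Phi -> tame Psi -> tame (fun g y => Cmult (Phi g y) (Psi g y)).
Proof.
  intros [R1 [[M1 [M1p B1]] [L1 [L1p H1]]]] [R2 [[M2 [M2p B2]] [L2 [L2p H2]]]].
  split; [intros; apply regular_mult; auto|split].
  - exists (M1 * M2). split; [nra|]. intros g y Hg. rewrite Cmod_mult.
    apply Rmult_le_compat; auto using Cmod_ge_0.
  - exists (L1 * M2 + M1 * L2). split; [nra|]. intros g1 g2 d A1 A2 Hd y.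
    pose proof (dist_nonneg _ _ _ Hd).
    replace (Cminus (Cmult (Phi g1 y) (Psi g1 y)) (Cmult (Phi g2 y) (Psi g2 y))) with
      (Cplus (Cmult (Cminus (Phi g1 y) (Phi g2 y)) (Psi g1 y))
             (Cmult (Phi g2 y) (Cminus (Psi g1 y) (Psi g2 y)))) by ring.
    eapply Rle_trans; [apply Cmod_triangle|]. rewrite !Cmod_mult.
    replace ((L1 * M2 + M1 * L2) * d) with ((L1 * d) * M2 + M1 * (L2 * d)) by ring.
    apply Rplus_le_compat; apply Rmult_le_compat; auto using Cmod_ge_0.
Qed.

Lemma tame_conj (Phi : (R -> C) -> R -> C) : tame Phi -> tame (fun g y => Cconj (Phi g y)).
Proof.
  intros [R1 [[M1 [M1p B1]] [L1 [L1p H1]]]].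
  split; [intros; apply regular_conj; auto|split].
  - exists M1. split; [assumption|]. intros. rewrite Cmod_conj. auto.
  - exists L1. split; [assumption|]. intros.
    replace (Cminus (Cconj (Phi g1 y)) (Cconj (Phi g2 y))) with (Cconj (Cminus (Phi g1 y) (Phi g2 y)))
      by (apply C_ext; simpl; ring).
    rewrite Cmod_conj. auto.
Qed.

Lemma tame_mean (Phi : (R -> C) -> R -> C) : tame Phi -> tame (fun g _ => mean (Phi g)).
Proof.
  intros [R1 [[M1 [M1p B1]] [L1 [L1p H1]]]].
  split; [intros; apply regular_mean; auto|split].
  - exists M1. split; [assumption|]. intros. apply mean_norm_le; [now apply R1|auto].
  - exists L1. split; [assumption|]. intros. apply mean_dist; [now apply R1|now apply R1|auto].
Qed.

Lemma tame_ext (Phi Psi : (R -> C) -> R -> C) : (forall g y, Phi g y = Psi g y) -> tame Phi -> tame Psi.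
Proof.
  intros E [R1 [[M1 [M1p B1]] [L1 [L1p H1]]]]. split; [|split].
  - intros g Hg. destruct (R1 g Hg) as [C1 [C2 C3]]. split; [exact (cont_ext _ _ (E g) C1)|].
    split; intro x; rewrite <- !E; auto.
  - exists M1. split; [assumption|]. intros. rewrite <- E. auto.
  - exists L1. split; [assumption|]. intros. rewrite <- !E. auto.
Qed.

(** Vanishing mean is what keeps the primitive periodic. For n = 0 and n = -1 the hypothesis is one
    of the two mean conditions in [admissible]. *)
Lemma tame_primitive0 (n : Z) :
  (forall g, admissible g -> mean (fun y => Cmult (wave n y) (g y)) = RtoC 0) ->
  tame (fun g => primitive0 (fun y => Cmult (wave n y) (g y))).
Proof.
  intro H0.
  assert (Hr : forall g, admissible g -> regular (fun y => Cmult (wave n y) (g y))).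
  { intros g [Hg _]. apply regular_mult; [apply wave_regular|assumption]. }
  pose proof PI_RGT_0.
  split; [|split].
  - intros g Hg. apply primitive0_regular; auto.
  - exists (4 * PI * 1). split; [lra|]. intros g y Hg. destruct (Hr g Hg) as [C1 [C2 C3]].
    apply primitive0_bound; auto. intro x. rewrite Cmod_mult, Cmod_wave, Rmult_1_l. apply Hg.
  - exists (4 * PI). split; [lra|]. intros g1 g2 d A1 A2 Hd y.
    destruct (Hr _ A1) as [C1 [C2 C3]]. destruct (Hr _ A2) as [D1 [D2 D3]].
    apply primitive0_lip; auto. intro x.
    replace (Cminus (Cmult (wave n x) (g1 x)) (Cmult (wave n x) (g2 x))) with
      (Cmult (wave n x) (Cminus (g1 x) (g2 x))) by ring.
    rewrite Cmod_mult, Cmod_wave, Rmult_1_l. apply Hd.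
Qed.

Definition nonlin (om : R) (m : nat) (z : C) : C := Cmult (RtoC (om * Cmod z ^ (2 * m))) z.

(** The even exponent makes |z|^(2m) equal to the polynomial (z conj z)^m, so closure under products
    and conjugation is enough. This is where it matters that p is odd. *)
Lemma tame_nonlin (om : R) (m : nat) (Phi : (R -> C) -> R -> C) :
  tame Phi -> tame (fun g y => nonlin om m (Phi g y)).
Proof.
  intro H. apply tame_mult; [|assumption].
  induction m as [|m IH].
  - apply (tame_ext (fun _ _ => RtoC om)); [intros; f_equal; simpl; ring|apply tame_real].
  - apply (tame_ext (fun g y => Cmult (RtoC (om * Cmod (Phi g y) ^ (2 * m)))
      (Cmult (Phi g y) (Cconj (Phi g y))))).
    + intros g y. rewrite <- Cmod2_conj, <- RtoC_mult. f_equal.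
      replace (2 * S m)%nat with (2 * m + 2)%nat by lia. rewrite pow_add. ring.
    + apply tame_mult; [assumption|]. apply tame_mult; [assumption|]. now apply tame_conj.
Qed.

Lemma admissible_uniform_limit (gn : nat -> R -> C) (g : R -> C) :
  (forall n, admissible (gn n)) ->
  (forall eps, 0 < eps -> exists n, forall y, Cmod (Cminus (gn n y) (g y)) <= eps) -> admissible g.
Proof.
  intros Hn Hu.
  assert (Hc : cont g) by (apply (cont_uniform_limit gn); [intro; apply Hn|assumption]).
  repeat split.
  - assumption.
  - intro x. apply Cmod_sub_small. intros eps Heps. destruct (Hu (eps / 2)) as [n H]; [lra|].
    eapply Rle_trans; [apply (Cmod_sub_triangle _ (gn n x))|].
    destruct (Hn n) as [[_ [Hp _]] _]. rewrite <- (Hp x) at 1. rewrite Cmod_opp_sub.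
    pose proof (H (x + 2 * PI)). pose proof (H x). lra.
  - intro x. apply Cmod_sub_small. intros eps Heps. destruct (Hu (eps / 2)) as [n H]; [lra|].
    eapply Rle_trans; [apply (Cmod_sub_triangle _ (gn n (- x)))|].
    destruct (Hn n) as [[_ [_ Hh]] _].
    pose proof (H (- x)) as H1. pose proof (H x) as H2. rewrite Cmod_opp_sub in H1.
    rewrite <- Cmod_conj in H2.
    replace (Cconj (Cminus (gn n x) (g x))) with (Cminus (gn n (- x)) (Cconj (g x))) in H2
      by (rewrite Hh; apply C_ext; simpl; ring).
    lra.
  - intro y. apply Rnot_lt_le. intro Hlt. destruct (Hu ((Cmod (g y) - 1) / 2)) as [n H]; [lra|].
    specialize (H y). rewrite Cmod_opp_sub in H.
    pose proof (Cmod_triangle (Cminus (g y) (gn n y)) (gn n y)) as Ht.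
    replace (Cplus (Cminus (g y) (gn n y)) (gn n y)) with (g y) in Ht by ring.
    destruct (Hn n) as [_ [Hb _]]. specialize (Hb y). lra.
  - apply Cmod_sub_small. intros eps Heps. destruct (Hu eps Heps) as [n H].
    destruct (Hn n) as [[Hcn _] [_ [H0 _]]]. rewrite <- H0. apply mean_dist; try assumption.
    intro x. rewrite Cmod_opp_sub. apply H.
  - apply Cmod_sub_small. intros eps Heps. destruct (Hu eps Heps) as [n H].
    destruct (Hn n) as [[Hcn _] [_ [_ H0]]]. rewrite <- H0.
    apply mean_dist; try (apply cont_mult; [apply wave_regular|assumption]).
    intro x. replace (Cminus (Cmult (wave (-1) x) (g x)) (Cmult (wave (-1) x) (gn n x))) with
      (Cmult (wave (-1) x) (Cminus (g x) (gn n x))) by ring.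
    rewrite Cmod_mult, Cmod_wave, Rmult_1_l, Cmod_opp_sub. apply H.
Qed.

Lemma admissible_zero : admissible (fun _ => RtoC 0).
Proof.
  split; [apply regular_const, Cconj_RtoC|repeat split].
  - intro. rewrite Cmod_0. lra.
  - apply mean_const.
  - rewrite (mean_ext _ (fun _ => RtoC 0)); [apply mean_const|]. intro. ring.
Qed.

(** * Existence of the periodic profile *)

Opaque mean integral primitive0 wave.

(* Variation of parameters: P = A + B e^(iy) with A' = i g, B' = - i e^(-iy) g, so that P' = i B e^(iy)
   and P'' - i P' = g. Here A, B, B e^(iy), P are amp0, amp1, flow, profile. *)
Definition amp0 (a : R) (g : R -> C) (y : R) : C :=
  Cplus (RtoC a) (primitive0 (fun z => Cmult (wave 0 z) (g z)) y).
Definition amp1 (K : R) (g : R -> C) (y : R) : C :=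
  Cplus (RtoC K) (Cmult (RtoC (-1)) (primitive0 (fun z => Cmult (wave (-1) z) (g z)) y)).
Definition flow (K : R) (g : R -> C) (y : R) : C := Cmult (amp1 K g y) (wave 1 y).
Definition profile (a K : R) (g : R -> C) (y : R) : C := Cplus (amp0 a g y) (flow K g y).
(* theta and gamma, chosen so that modes 0 and 1 of the residual vanish. *)
Definition phase_rate (om : R) (m : nat) (a K : R) (g : R -> C) : C :=
  Cmult (RtoC (/ a)) (mean (fun y => nonlin om m (profile a K g y))).
Definition drift (om : R) (m : nat) (a K : R) (g : R -> C) : C :=
  Cplus (phase_rate om m a K g)
    (Cmult (RtoC (- / K)) (mean (fun y => Cmult (wave (-1) y) (nonlin om m (profile a K g y))))).
Definition residual (om : R) (m : nat) (a K : R) (g : R -> C) (y : R) : C :=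
  Cplus (nonlin om m (profile a K g y))
    (Cplus (Cmult (RtoC (-1)) (Cmult (phase_rate om m a K g) (profile a K g y)))
       (Cmult (drift om m a K g) (flow K g y))).

Lemma tame_amp0 (a : R) : tame (amp0 a).
Proof.
  apply tame_plus; [apply tame_real|]. apply tame_primitive0.
  intros g [_ [_ [H _]]]. rewrite <- H. apply mean_ext. intro y. rewrite wave_0. ring.
Qed.

Lemma tame_amp1 (K : R) : tame (amp1 K).
Proof.
  apply tame_plus; [apply tame_real|]. apply tame_mult; [apply tame_real|].
  apply tame_primitive0. intros g Hg. apply Hg.
Qed.

Lemma tame_flow (K : R) : tame (flow K).
Proof. apply tame_mult; [apply tame_amp1|apply tame_wave]. Qed.

Lemma tame_profile (a K : R) : tame (profile a K).
Proof. apply tame_plus; [apply tame_amp0|apply tame_flow]. Qed.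

Lemma tame_phase_rate (om : R) (m : nat) (a K : R) : tame (fun g _ => phase_rate om m a K g).
Proof.
  apply tame_mult; [apply tame_real|].
  apply (tame_mean (fun g y => nonlin om m (profile a K g y))), tame_nonlin, tame_profile.
Qed.

Lemma tame_drift (om : R) (m : nat) (a K : R) : tame (fun g _ => drift om m a K g).
Proof.
  apply tame_plus; [apply tame_phase_rate|]. apply tame_mult; [apply tame_real|].
  apply (tame_mean (fun g y => Cmult (wave (-1) y) (nonlin om m (profile a K g y)))).
  apply tame_mult; [apply tame_wave|]. apply tame_nonlin, tame_profile.
Qed.

Lemma tame_residual (om : R) (m : nat) (a K : R) : tame (residual om m a K).
Proof.
  apply tame_plus; [apply tame_nonlin, tame_profile|]. apply tame_plus.
  - apply tame_mult; [apply tame_real|]. apply tame_mult; [apply tame_phase_rate|apply tame_profile].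
  - apply tame_mult; [apply tame_drift|apply tame_flow].
Qed.

(** * Modes 0 and 1 of the profile and of the residual *)

Section Modes.

Variables (a K : R) (g : R -> C).
Hypothesis Hg : admissible g.

Let g_cont : cont g := proj1 (proj1 Hg).
Let amp0_cont : cont (amp0 a g) := proj1 (proj1 (tame_amp0 a) g Hg).
Let amp1_cont : cont (amp1 K g) := proj1 (proj1 (tame_amp1 K) g Hg).

Lemma amp0_deriv (y : R) : deriv_at (amp0 a g) y (Cmult Ci (g y)).
Proof.
  unfold amp0 at 1.
  eapply deriv_eq; [apply deriv_plus; [apply deriv_const|apply primitive0_deriv]|reflexivity|].
  - apply cont_mult; [apply wave_regular|assumption].
  - cbv beta. rewrite wave_0. ring.
Qed.

Lemma amp1_deriv (y : R) : deriv_at (amp1 K g) y (Copp (Cmult Ci (Cmult (wave (-1) y) (g y)))).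
Proof.
  unfold amp1 at 1.
  eapply deriv_eq; [apply deriv_plus; [apply deriv_const|apply deriv_mult; [apply deriv_const|apply primitive0_deriv]]|reflexivity|].
  - apply cont_mult; [apply wave_regular|assumption].
  - cbv beta. ring.
Qed.

Lemma flow_deriv (y : R) : deriv_at (flow K g) y (Cminus (Cmult Ci (flow K g y)) (Cmult Ci (g y))).
Proof.
  unfold flow at 1.
  eapply deriv_eq; [apply deriv_mult; [apply amp1_deriv|apply wave_deriv]|reflexivity|].
  cbv beta. unfold flow.
  replace (Cmult (Copp (Cmult Ci (Cmult (wave (-1) y) (g y)))) (wave 1 y)) with
    (Copp (Cmult (Cmult (wave (-1) y) (wave 1 y)) (Cmult Ci (g y)))) by ring.
  rewrite wave_mul, wave_0. simpl IZR. ring.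
Qed.

(** The term i g from [amp0] cancels the term - i g from [flow], as variation of parameters is
    designed to achieve. *)
Lemma profile_deriv (y : R) : deriv_at (profile a K g) y (Cmult Ci (flow K g y)).
Proof.
  unfold profile at 1.
  eapply deriv_eq; [apply deriv_plus; [apply amp0_deriv|apply flow_deriv]|reflexivity|cbv beta; ring].
Qed.

Lemma mean_amp0 : mean (amp0 a g) = RtoC a.
Proof.
  unfold amp0. assert (cont (fun z => Cmult (wave 0 z) (g z))) by (apply cont_mult; [apply wave_regular|assumption]).
  rewrite mean_plus, mean_const, primitive0_mean; [ring|assumption|apply cont_const|].
  refine (deriv_cont _ _ (fun x => primitive0_deriv _ x _)). assumption.
Qed.

Lemma mean_amp1 : mean (amp1 K g) = RtoC K.
Proof.
  unfold amp1. assert (cont (fun z => Cmult (wave (-1) z) (g z))) by (apply cont_mult; [apply wave_regular|assumption]).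
  assert (cont (primitive0 (fun z => Cmult (wave (-1) z) (g z)))).
  { refine (deriv_cont _ _ (fun x => primitive0_deriv _ x _)). assumption. }
  rewrite mean_plus, mean_const, mean_scal, primitive0_mean; [ring|assumption|assumption|apply cont_const|].
  apply cont_mult; [apply cont_const|assumption].
Qed.

(** The derivative i flow - i g of a periodic function has mean zero, and so has g. *)
Lemma mean_flow : mean (flow K g) = RtoC 0.
Proof.
  assert (Hfc : cont (flow K g)) by apply (proj1 (tame_flow K) g Hg).
  pose proof (mean_deriv _ _ flow_deriv) as H.
  rewrite mean_minus, !mean_scal in H; try assumption; try (apply cont_mult; [apply cont_const|assumption]).
  pose proof (proj1 (proj2 (proj2 Hg))) as H0. rewrite H0 in H.
  replace (mean (flow K g)) with (Cmult (Copp Ci) (Cminus (Cmult Ci (mean (flow K g))) (Cmult Ci (RtoC 0)))).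
  - rewrite H; [ring| |apply (proj1 (tame_flow K) g Hg)].
    apply cont_minus; (apply cont_mult; [apply cont_const|assumption]).
  - apply C_ext; simpl; ring.
Qed.

(** The same device in mode 1: the derivative of e^(-iy) A is - i e^(-iy) A + i e^(-iy) g, and both
    the left-hand side and the last term have mean zero. *)
Lemma mean_wave_amp0 : mean (fun y => Cmult (wave (-1) y) (amp0 a g y)) = RtoC 0.
Proof.
  assert (D : forall y, deriv_at (fun y => Cmult (wave (-1) y) (amp0 a g y)) y
    (Cplus (Cmult (Copp Ci) (Cmult (wave (-1) y) (amp0 a g y))) (Cmult Ci (Cmult (wave (-1) y) (g y))))).
  { intro y. eapply deriv_eq; [apply deriv_mult; [apply wave_deriv|apply amp0_deriv]|reflexivity|].
    cbv beta. replace (RtoC (IZR (-1))) with (Copp (RtoC 1)) by (apply C_ext; simpl; ring). ring. }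
  assert (c1 : cont (fun y => Cmult (wave (-1) y) (amp0 a g y))) by (apply cont_mult; [apply wave_regular|assumption]).
  assert (c2 : cont (fun y => Cmult (wave (-1) y) (g y))) by (apply cont_mult; [apply wave_regular|assumption]).
  pose proof (mean_deriv _ _ D) as H.
  rewrite mean_plus, !mean_scal in H; try assumption; try (apply cont_mult; [apply cont_const|assumption]).
  pose proof (proj2 (proj2 (proj2 Hg))) as H0. rewrite H0 in H.
  assert (Hz : forall z : C, Cplus (Cmult (Copp Ci) z) (Cmult Ci (RtoC 0)) = RtoC 0 -> z = RtoC 0).
  { intros z E. replace z with (Cmult Ci (Cplus (Cmult (Copp Ci) z) (Cmult Ci (RtoC 0)))).
    - rewrite E. ring.
    - apply C_ext; simpl; ring. }
  apply Hz, H.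
  - apply cont_plus; (apply cont_mult; [apply cont_const|assumption]).
  - intro x. destruct (wave_regular (-1)) as [_ [Hw _]]. rewrite Hw.
    f_equal. apply (proj1 (tame_amp0 a) g Hg).
Qed.

Lemma mean_profile : mean (profile a K g) = RtoC a.
Proof.
  unfold profile. rewrite mean_plus, mean_amp0, mean_flow; [ring|assumption|].
  apply (proj1 (tame_flow K) g Hg).
Qed.

Lemma mean_wave_flow : mean (fun y => Cmult (wave (-1) y) (flow K g y)) = RtoC K.
Proof.
  rewrite <- mean_amp1. apply mean_ext. intro y. unfold flow.
  replace (Cmult (wave (-1) y) (Cmult (amp1 K g y) (wave 1 y))) with
    (Cmult (Cmult (wave (-1) y) (wave 1 y)) (amp1 K g y)) by ring.
  rewrite wave_mul, wave_0. ring.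
Qed.

(** Together with [mean_profile]: modes 0 and 1 of the profile are a and K whatever g is. The
    solvability conditions are therefore linear in theta and gamma with fixed coefficients. *)
Lemma mean_wave_profile : mean (fun y => Cmult (wave (-1) y) (profile a K g y)) = RtoC K.
Proof.
  rewrite (mean_ext _ (fun y => Cplus (Cmult (wave (-1) y) (amp0 a g y)) (Cmult (wave (-1) y) (flow K g y))))
    by (intro; unfold profile; ring).
  rewrite mean_plus, mean_wave_amp0, mean_wave_flow; [ring| |];
    (apply cont_mult; [apply wave_regular|]); [assumption|apply (proj1 (tame_flow K) g Hg)].
Qed.

Variables (om : R) (m : nat).
Hypotheses (Ha : a <> 0) (HK : K <> 0).

Let profile_cont : cont (profile a K g) := proj1 (proj1 (tame_profile a K) g Hg).
Let flow_cont : cont (flow K g) := proj1 (proj1 (tame_flow K) g Hg).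
Let nonlin_cont : cont (fun y => nonlin om m (profile a K g y)) :=
  proj1 (proj1 (tame_nonlin om m _ (tame_profile a K)) g Hg).

(** Mode 0 of the residual is F_0 - theta a, with F_0 the mean of the nonlinear term, because [flow]
    has mean zero; [phase_rate] is F_0 / a. *)
Lemma mean_residual : mean (residual om m a K g) = RtoC 0.
Proof.
  unfold residual.
  assert (cont (fun y => Cmult (phase_rate om m a K g) (profile a K g y)))
    by (apply cont_mult; [apply cont_const|assumption]).
  assert (cont (fun y => Cmult (RtoC (-1)) (Cmult (phase_rate om m a K g) (profile a K g y))))
    by (apply cont_mult; [apply cont_const|assumption]).
  assert (cont (fun y => Cmult (drift om m a K g) (flow K g y)))
    by (apply cont_mult; [apply cont_const|assumption]).
  rewrite mean_plus, mean_plus, !mean_scal; try assumption; [|apply cont_plus; assumption].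
  rewrite mean_profile, mean_flow. unfold phase_rate.
  rewrite RtoC_inv by assumption. field. intro E. apply Ha. now injection E.
Qed.

(** Mode 1 of the residual is F_1 - theta K + gamma K, with F_1 that of the nonlinear term. The
    system is triangular: theta is already fixed, and [drift] is theta - F_1 / K. *)
Lemma mean_wave_residual : mean (fun y => Cmult (wave (-1) y) (residual om m a K g y)) = RtoC 0.
Proof.
  rewrite (mean_ext _ (fun y => Cplus (Cmult (wave (-1) y) (nonlin om m (profile a K g y)))
    (Cplus (Cmult (Copp (phase_rate om m a K g)) (Cmult (wave (-1) y) (profile a K g y)))
       (Cmult (drift om m a K g) (Cmult (wave (-1) y) (flow K g y)))))).
  2: { intro. unfold residual. replace (RtoC (-1)) with (Copp (RtoC 1)) by (apply C_ext; simpl; ring). ring. }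
  assert (cont (fun y => Cmult (wave (-1) y) (nonlin om m (profile a K g y)))) by (apply cont_mult; [apply wave_regular|assumption]).
  assert (cont (fun y => Cmult (wave (-1) y) (profile a K g y))) by (apply cont_mult; [apply wave_regular|assumption]).
  assert (cont (fun y => Cmult (wave (-1) y) (flow K g y))) by (apply cont_mult; [apply wave_regular|assumption]).
  assert (cont (fun y => Cmult (Copp (phase_rate om m a K g)) (Cmult (wave (-1) y) (profile a K g y))))
    by (apply cont_mult; [apply cont_const|assumption]).
  assert (cont (fun y => Cmult (drift om m a K g) (Cmult (wave (-1) y) (flow K g y))))
    by (apply cont_mult; [apply cont_const|assumption]).
  rewrite mean_plus, mean_plus, !mean_scal; try assumption; [|apply cont_plus; assumption].
  rewrite mean_wave_profile, mean_wave_flow. unfold drift.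
  rewrite RtoC_opp, RtoC_inv by assumption. field. intro E. apply HK. now injection E.
Qed.

End Modes.

Lemma primitive0_zero (h : R -> C) (y : R) : (forall x, h x = RtoC 0) -> primitive0 h y = RtoC 0.
Proof.
  intro H. apply Cmod_eq_0, Rle_antisym; [|apply Cmod_ge_0].
  assert (Hc : cont h) by (apply (cont_ext (fun _ => RtoC 0)); [auto|apply cont_const]).
  eapply Rle_trans; [apply (primitive0_bound h 0)|rewrite Rmult_0_r; apply Rle_refl].
  - assumption.
  - intro x. now rewrite !H.
  - rewrite (mean_ext _ (fun _ => RtoC 0)) by assumption. apply mean_const.
  - intro x. rewrite H, Cmod_0. apply Rle_refl.
Qed.

Lemma profile_zero (a K y : R) :
  profile a K (fun _ => RtoC 0) y = Cplus (RtoC a) (Cmult (RtoC K) (wave 1 y)).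
Proof.
  unfold profile, amp0, flow, amp1. rewrite !primitive0_zero; [ring| |]; intro; ring.
Qed.

(** The phase rate at g = 0, that is for the profile a + K e^(iy). It does not involve N, so the gap
    between the rates can be secured before N is chosen. *)
Definition rate0 (om : R) (m : nat) (a K : R) : R :=
  / a * fst (mean (fun y => nonlin om m (Cplus (RtoC a) (Cmult (RtoC K) (wave 1 y))))).

(** Here W is - i P', so the profile equation becomes a first-order system whose right-hand sides
    are polynomials in P, W and conj P. The bound M precedes eps, hence is uniform in eps. *)
Lemma profile_exists (om : R) (m : nat) (a K : R) : a <> 0 -> K <> 0 ->
  exists M eps0, 0 < eps0 /\ forall eps, 0 < eps < eps0 ->
  exists (P W : R -> C) (tau gam : R),
    (forall y, deriv_at P y (Cmult Ci (W y))) /\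
    (forall y, deriv_at W y (Cminus (Cmult Ci (W y)) (Cmult (Cmult Ci (RtoC eps))
       (Cplus (nonlin om m (P y)) (Cplus (Cmult (RtoC (- tau)) (P y)) (Cmult (RtoC gam) (W y))))))) /\
    periodic P /\ (forall y, Cmod (P y) <= M) /\ mean P = RtoC a /\
    Rabs (tau - rate0 om m a K) <= 1.
Proof.
  intros Ha HK.
  destruct (tame_residual om m a K) as [Rr [[Mr [Mrp Br]] [Lr [Lrp Hr]]]].
  destruct (tame_phase_rate om m a K) as [Rt [_ [Lt [Ltp Ht]]]].
  destruct (tame_drift om m a K) as [Rd _].
  destruct (tame_profile a K) as [Rp [[M [Mp Bp]] _]].
  assert (0 <= Lt * Mr) by now apply Rmult_le_pos.
  (* The inequality eps q <= 1 yields three facts at once: eps Mr <= 1 keeps the map in the unit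
     ball, eps Lr <= 1/2 makes it a contraction, and eps Lt Mr <= 1 keeps the phase rate within 1 of
     [rate0]. *)
  set (q := 1 + Mr + 2 * Lr + Lt * Mr).
  assert (q1 : Mr <= q) by (unfold q; lra).
  assert (q2 : 2 * Lr <= q) by (unfold q; lra).
  assert (q3 : Lt * Mr <= q) by (unfold q; lra).
  assert (q0 : 0 < q) by (unfold q; lra).
  exists M, (/ q). split; [now apply Rinv_0_lt_compat|]. intros eps [E0 E1].
  assert (Eq : eps * q <= 1).
  { apply Rmult_lt_compat_r with (r := q) in E1; [|assumption]. rewrite Rinv_l in E1 by lra. lra. }
  destruct (contraction_fixed_point admissible
    (fun g y => Cmult (RtoC eps) (residual om m a K g y)) (fun _ => RtoC 0)) as [g [Hg Efix]].
  - exact admissible_zero.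
  - intros g Hg. split; [apply regular_mult; [apply regular_const, Cconj_RtoC|auto]|split; [|split]].
    + intro y. rewrite Cmod_mult, Cmod_R, Rabs_pos_eq by lra. specialize (Br g y Hg). nra.
    + rewrite mean_scal by apply (Rr g Hg). rewrite mean_residual by assumption. ring.
    + rewrite (mean_ext _ (fun y => Cmult (RtoC eps) (Cmult (wave (-1) y) (residual om m a K g y)))) by (intro; ring).
      rewrite mean_scal, mean_wave_residual by (assumption || (apply cont_mult; [apply wave_regular|apply (Rr g Hg)])).
      ring.
  - intros g Hg. apply Hg.
  - intros g1 g2 d A1 A2 Hd y.
    replace (Cminus (Cmult (RtoC eps) (residual om m a K g1 y)) (Cmult (RtoC eps) (residual om m a K g2 y)))
      with (Cmult (RtoC eps) (Cminus (residual om m a K g1 y) (residual om m a K g2 y))) by ring.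
    rewrite Cmod_mult, Cmod_R, Rabs_pos_eq by lra.
    specialize (Hr g1 g2 d A1 A2 Hd y). pose proof (dist_nonneg _ _ _ Hd).
    apply Rle_trans with (eps * (Lr * d)); [apply Rmult_le_compat_l; lra|].
    assert (eps * Lr <= / 2) by nra. nra.
  - exact admissible_uniform_limit.
  (* A constant function that is hermitian has a real value; tameness of [phase_rate] and [drift]
     supplies the symmetry. *)
  - assert (real_const : forall c : C, regular (fun _ => c) -> RtoC (fst c) = c).
    { intros c [_ [_ Hc]]. specialize (Hc 0). apply (f_equal snd) in Hc. simpl in Hc.
      apply C_ext; simpl; lra. }
    exists (profile a K g), (flow K g), (fst (phase_rate om m a K g)), (fst (drift om m a K g)).
    rewrite RtoC_opp, !real_const by (apply (Rt g Hg) || apply (Rd g Hg)).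
    split; [|split; [|split; [|split; [|split]]]].
    + intro y. now apply profile_deriv.
    + intro y. refine (deriv_eq _ _ _ _ _ (flow_deriv K g Hg y) (fun _ => eq_refl) _). rewrite <- Efix.
      unfold residual. replace (RtoC (-1)) with (Copp (RtoC 1)) by (apply C_ext; simpl; ring). ring.
    + apply (Rp g Hg).
    + intro y. now apply Bp.
    + now apply mean_profile.
    + assert (E : rate0 om m a K = fst (phase_rate om m a K (fun _ => RtoC 0))).
      { unfold rate0, phase_rate.
        rewrite (mean_ext (fun y => nonlin om m (profile a K (fun _ => RtoC 0) y))
          (fun y => nonlin om m (Cplus (RtoC a) (Cmult (RtoC K) (wave 1 y))))) by (intro; now rewrite profile_zero).
        simpl. ring. }
      rewrite E. eapply Rle_trans; [apply Re_sub_le|].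
      (* The fixed point g = eps * residual lies within eps Mr of 0, so the Lipschitz bound compares
         theta at g with theta at 0. *)
      eapply Rle_trans; [apply (Ht g (fun _ => RtoC 0) (eps * Mr) Hg admissible_zero)|nra].
      * intro y. rewrite <- Efix.
        replace (Cminus (Cmult (RtoC eps) (residual om m a K g y)) (RtoC 0)) with
          (Cmult (RtoC eps) (residual om m a K g y)) by ring.
        rewrite Cmod_mult, Cmod_R, Rabs_pos_eq by lra. apply Rmult_le_compat_l; [lra|now apply Br].
      * exact 0.
Qed.

Transparent mean integral primitive0 wave.

(** * Travelling waves *)

Lemma pow_tangent_le (c s : R) (k : nat) : 0 <= c -> 0 <= c + s ->
  c ^ S k + INR (S k) * c ^ k * s <= (c + s) ^ S k.
Proof.
  intros Hc Hs. induction k as [|k IH]; [simpl; lra|].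
  (* Multiplying the induction hypothesis by c + s >= 0 produces the next tangent line plus the
     surplus (k + 1) c^k s^2. *)
  apply Rle_trans with ((c + s) * (c ^ S k + INR (S k) * c ^ k * s)).
  - rewrite (S_INR (S k)). simpl pow.
    pose proof (pow_le c k Hc). pose proof (pos_INR (S k)).
    assert (0 <= INR (S k) * c ^ k * (s * s)) by (apply Rmult_le_pos; [now apply Rmult_le_pos|apply Rle_0_sqr]).
    lra.
  - simpl pow in *. now apply Rmult_le_compat_l.
Qed.

Lemma pow_diff_same_sign (c s : R) (m : nat) : 0 <= c -> 0 <= c + s -> 0 <= ((c + s) ^ m - c ^ m) * s.
Proof.
  intros Hc Hs. destruct (Rle_or_lt 0 s).
  - pose proof (pow_incr c (c + s) m ltac:(lra)). nra.
  - pose proof (pow_incr (c + s) c m ltac:(lra)). nra.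
Qed.

Lemma mean_Re_nonneg (f : R -> C) : cont f -> (forall y, 0 <= fst (f y)) -> 0 <= fst (mean f).
Proof.
  intros Hf H. pose proof PI_RGT_0.
  pose proof (is_RInt_fct_extend_fst (U := R_NormedModule) (V := R_NormedModule) f _ _ _ (is_RInt_integral f 0 (2 * PI) Hf)) as HI.
  assert (Hge : 0 <= fst (integral f 0 (2 * PI))).
  { refine (is_RInt_le _ _ 0 (2 * PI) 0 _ _ _ HI _); [lra| |intros; apply H].
    pose proof (is_RInt_const (V := R_NormedModule) 0 (2 * PI) 0) as Hz.
    replace (scal (2 * PI - 0) (0 : R_NormedModule)) with (0 : R_NormedModule) in Hz; [exact Hz|].
    unfold scal; simpl; unfold mult; simpl; ring. }
  unfold mean. simpl. rewrite Rmult_0_l, Rminus_0_r.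
  apply Rmult_le_pos; [left; apply Rinv_0_lt_compat; lra|assumption].
Qed.

(* With c = a^2 + K^2 one has |a + K e^(iy)|^2 = c + 2 a K cos y. The tangent line to x^(k+1) at c bounds
   the mean of |a + K e^(iy)|^(2k+2) below by c^(k+1), and its mean against cos y is nonnegative. *)
Lemma rate0_lower_bound (om : R) (k : nat) (a K : R) : om = 1 \/ om = -1 -> 0 < a -> 0 < K ->
  (a ^ 2 + K ^ 2) ^ S k <= om * rate0 om (S k) a K.
Proof.
  intros Hom Ha HK. assert (Hom2 : om * om = 1) by (destruct Hom; subst; ring).
  set (c := a ^ 2 + K ^ 2).
  (* b collects the coefficients of cos y in the pointwise bound om Re F(y) >= a c^(k+1) + b cos y.
     Since e^(iy) has mean zero, only a c^(k+1) survives averaging. *)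
  set (b := a * (INR (S k) * c ^ k * (2 * a * K)) + K * c ^ S k).
  set (F := fun y => nonlin om (S k) (Cplus (RtoC a) (Cmult (RtoC K) (wave 1 y)))).
  assert (HF : cont F).
  { exact (proj1 (proj1 (tame_nonlin om (S k) _ (tame_plus _ _ (tame_real a) (tame_mult _ _ (tame_real K) (tame_wave 1))))
      _ admissible_zero)). }
  assert (Hwave : cont (fun y => Cmult (RtoC b) (wave 1 y)))
    by (apply cont_mult; [apply cont_const|apply wave_regular]).
  assert (HoF : cont (fun y => Cmult (RtoC om) (F y)))
    by (apply cont_mult; [apply cont_const|assumption]).
  assert (Hm : 0 <= fst (mean (fun y => Cminus (Cmult (RtoC om) (F y)) (Cplus (RtoC (a * c ^ S k)) (Cmult (RtoC b) (wave 1 y)))))).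
  { apply mean_Re_nonneg.
    - apply cont_minus; [assumption|]. apply cont_plus; [apply cont_const|assumption].
    - intro y. unfold F, nonlin. set (z := Cplus (RtoC a) (Cmult (RtoC K) (wave 1 y))).
      assert (z1 : fst z = a + K * cos y).
      { unfold z, wave, expi. simpl. replace (1 * y) with y by ring. ring. }
      assert (z2 : Cmod z ^ 2 = c + 2 * a * K * cos y).
      { unfold Cmod. rewrite pow2_sqrt by nra. rewrite z1.
        replace (snd z) with (K * sin y) by (unfold z, wave, expi; simpl; replace (1 * y) with y by ring; ring).
        pose proof (sin2_cos2 y) as Hsc. unfold Rsqr in Hsc. unfold c. simpl.
        nra. }
      assert (Hpow : Cmod z ^ (2 * S k) = (c + 2 * a * K * cos y) ^ S k) by (rewrite pow_mult, z2; reflexivity).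
      rewrite Hpow.
      assert (Hc : 0 <= c) by (unfold c; nra).
      assert (Hcs : 0 <= c + 2 * a * K * cos y) by (rewrite <- z2; apply pow2_ge_0).
      pose proof (pow_tangent_le c _ k Hc Hcs) as H1.
      pose proof (pow_diff_same_sign c _ (S k) Hc Hcs) as H2.
      set (X := (c + 2 * a * K * cos y) ^ S k) in *.
      assert (H3 : 0 <= (X - c ^ S k) * cos y).
      { apply Rmult_le_reg_l with (2 * a * K); [nra|]. lra. }
      assert (HRe : forall (o r q t : R) (u w : C), fst (Cminus (Cmult (RtoC o) (Cmult (RtoC (o * r)) u))
        (Cplus (RtoC q) (Cmult (RtoC t) w))) = (o * o) * r * fst u - (q + t * fst w)) by (intros; simpl; ring).
      rewrite HRe, Hom2, z1. replace (fst (wave 1 y)) with (cos y) by (unfold wave, expi; simpl; f_equal; ring).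
      unfold b.
      assert (H4 : a * (c ^ S k + INR (S k) * c ^ k * (2 * a * K * cos y)) <= a * X) by (apply Rmult_le_compat_l; lra).
      assert (H5 : 0 <= K * ((X - c ^ S k) * cos y)) by (apply Rmult_le_pos; lra).
      lra. }
  rewrite mean_minus, mean_plus, mean_const, !mean_scal in Hm; try assumption;
    [|apply wave_regular|apply cont_const|apply cont_plus; [apply cont_const|assumption]].
  assert (Hw : mean (wave 1) = RtoC 0).
  { assert (Hd : mean (fun y => Cmult (Cmult Ci (RtoC 1)) (wave 1 y)) = RtoC 0).
    { apply (mean_deriv (wave 1)); [intro; apply wave_deriv| |apply wave_regular].
      apply cont_mult; [apply cont_const|apply wave_regular]. }
    rewrite mean_scal in Hd by apply wave_regular.
    replace (mean (wave 1)) with (Cmult (Copp Ci) (Cmult (Cmult Ci (RtoC 1)) (mean (wave 1)))) by (apply C_ext; simpl; ring).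
    rewrite Hd. ring. }
  rewrite Hw in Hm. unfold rate0. fold F. simpl in Hm. fold (c ^ S k) in Hm.
  apply Rmult_le_reg_l with a; [assumption|].
  replace (a * (om * (/ a * fst (mean F)))) with (om * fst (mean F)) by (field; lra).
  simpl. lra.
Qed.

(* The derivatives of P and W = - i P' are polynomials in P, W and their conjugates; symbolic
   differentiation of such polynomials yields all the derivatives of P at once. *)
Inductive expr : Type :=
| EP | EPc | EW | EWc | Econst (c : C) | Eadd (e f : expr) | Emul (e f : expr).

Fixpoint eval (P W : R -> C) (e : expr) (y : R) : C :=
  match e with
  | EP => P y
  | EPc => Cconj (P y)
  | EW => W y
  | EWc => Cconj (W y)
  | Econst c => c
  | Eadd e f => Cplus (eval P W e y) (eval P W f y)
  | Emul e f => Cmult (eval P W e y) (eval P W f y)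
  end.

Fixpoint econj (e : expr) : expr :=
  match e with
  | EP => EPc
  | EPc => EP
  | EW => EWc
  | EWc => EW
  | Econst c => Econst (Cconj c)
  | Eadd e f => Eadd (econj e) (econj f)
  | Emul e f => Emul (econj e) (econj f)
  end.

Lemma eval_econj (P W : R -> C) (e : expr) (y : R) : eval P W (econj e) y = Cconj (eval P W e y).
Proof.
  induction e; simpl; try reflexivity; try (apply C_ext; simpl; ring);
    rewrite IHe1, IHe2; apply C_ext; simpl; ring.
Qed.

Fixpoint ediff (dP dW : expr) (e : expr) : expr :=
  match e with
  | EP => dP
  | EPc => econj dP
  | EW => dW
  | EWc => econj dW
  | Econst c => Econst (RtoC 0)
  | Eadd e f => Eadd (ediff dP dW e) (ediff dP dW f)
  | Emul e f => Eadd (Emul (ediff dP dW e) f) (Emul e (ediff dP dW f))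
  end.

Lemma eval_deriv (P W : R -> C) (dP dW : expr) :
  (forall y, deriv_at P y (eval P W dP y)) -> (forall y, deriv_at W y (eval P W dW y)) ->
  forall e y, deriv_at (eval P W e) y (eval P W (ediff dP dW e) y).
Proof.
  intros HP HW e y. induction e; simpl.
  - apply HP.
  - rewrite eval_econj. apply deriv_conj, HP.
  - apply HW.
  - rewrite eval_econj. apply deriv_conj, HW.
  - apply deriv_const.
  - now apply deriv_plus.
  - now apply deriv_mult.
Qed.

Fixpoint epow (e : expr) (m : nat) : expr :=
  match m with O => Econst (RtoC 1) | S m => Emul e (epow e m) end.

Definition enonlin (om : R) (m : nat) : expr :=
  Emul (Emul (Econst (RtoC om)) (epow (Emul EP EPc) m)) EP.

Lemma eval_enonlin (P W : R -> C) (om : R) (m : nat) (y : R) :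
  eval P W (enonlin om m) y = nonlin om m (P y).
Proof.
  unfold nonlin. simpl. f_equal. rewrite RtoC_mult. f_equal.
  induction m as [|m IH]; [reflexivity|].
  cbn [epow eval]. rewrite IH, <- Cmod2_conj, <- RtoC_mult, <- pow_add. do 2 f_equal. lia.
Qed.

Lemma derivative_sequence (P W : R -> C) (dW : expr) :
  (forall y, deriv_at P y (Cmult Ci (W y))) -> (forall y, deriv_at W y (eval P W dW y)) ->
  exists Pd : nat -> R -> C,
    (forall n y, deriv_at (Pd n) y (Pd (S n) y)) /\
    forall y, Pd 0%nat y = P y /\ Pd 1%nat y = Cmult Ci (W y) /\ Pd 2%nat y = Cmult Ci (eval P W dW y).
Proof.
  intros HP HW.
  set (dP := Emul (Econst Ci) EW).
  exists (fun n => eval P W (Nat.iter n (ediff dP dW) EP)). split.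
  - intros n y. apply (eval_deriv P W dP dW); assumption.
  - intro y. simpl. split; [reflexivity|split; [reflexivity|ring]].
Qed.

Lemma derive_within_of_deriv (I : R -> Prop) (f : R -> C) (t : R) (l : C) :
  I t -> deriv_at f t l -> is_derive_within I f t l.
Proof.
  intros It [Hlin Hd]. split; [exact Hlin|].
  (* [filterdiff] asks for the estimate at every limit x of the filter. As t belongs to I, every set
     of the filter contains t, so x <> t would give |t - x| < |t - x|. *)
  intros x Hx. assert (Ex : x = t).
  { destruct (Req_dec x t) as [E|E]; [assumption|exfalso].
    assert (Hr : 0 < Rabs (t - x)) by (apply Rabs_pos_lt; lra).
    assert (HI : within I (locally t) (fun z => Rabs (z - x) < Rabs (t - x))).
    { apply Hx. exists (mkposreal _ Hr). intros z Hz. exact Hz. }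
    apply locally_singleton in HI. specialize (HI It). lra. }
  subst x. intro eps.
  assert (Ht : is_filter_lim (locally t) t) by (intros Q HQ; exact HQ).
  apply (filter_le_within I _ (Hd t Ht eps)).
Qed.

Lemma deriv_expi_mul_affine (th ka c t : R) (F F' : R -> C) : (forall y, deriv_at F y (F' y)) ->
  deriv_at (fun t => Cmult (expi (th * t)) (F (c + ka * t))) t
    (Cmult (expi (th * t)) (Cplus (Cmult (Cmult Ci (RtoC th)) (F (c + ka * t))) (Cmult (RtoC ka) (F' (c + ka * t))))).
Proof.
  intro HF. eapply deriv_eq.
  - apply deriv_mult; [apply deriv_expi_lin|].
    apply (deriv_comp_affine F ka c). apply HF.
  - intro y. cbv beta. now rewrite (Rplus_comm (ka * y)).
  - cbv beta. rewrite (Rplus_comm (ka * t)). ring.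
Qed.

Section TravellingWave.

Variables (Pd : nat -> R -> C) (th ka : R) (N : nat).
Hypothesis HPd : forall n y, deriv_at (Pd n) y (Pd (S n) y).

(* (i th + ka d/dy)^j applied to the n-th derivative of the profile. *)
Fixpoint dt_profile (j n : nat) (y : R) : C :=
  match j with
  | O => Pd n y
  | S j => Cplus (Cmult (Cmult Ci (RtoC th)) (dt_profile j n y)) (Cmult (RtoC ka) (dt_profile j (S n) y))
  end.

Lemma dt_profile_deriv (j n : nat) (y : R) : deriv_at (dt_profile j n) y (dt_profile j (S n) y).
Proof.
  revert n. induction j as [|j IH]; intro n; simpl; [apply HPd|].
  eapply deriv_eq; [apply deriv_plus; (apply deriv_mult; [apply deriv_const|apply IH])|reflexivity|cbv beta; ring].
Qed.

Definition travelling_partial (j k : nat) (t x : R) : C :=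
  Cmult (expi (th * t)) (Cmult (RtoC (INR N ^ k)) (dt_profile j k (INR N * x + ka * t))).

Lemma travelling_smooth (I : R -> Prop) :
  smooth_with_partials I (fun t x => Cmult (expi (th * t)) (Pd 0%nat (INR N * x + ka * t))) travelling_partial.
Proof.
  intros t x It. split; [unfold travelling_partial; simpl; ring|]. intros j k. split; [|split].
  - eapply filterlim_filter_le_1; [apply filter_le_within|].
    change (continuous (U := C_UniformSpace) (fun z : R * R => travelling_partial j k (fst z) (snd z)) (t, x)).
    unfold travelling_partial.
    assert (c1 : continuous (fun z : R * R => fst z) (t, x)) by apply continuous_fst.
    assert (c2 : continuous (fun z : R * R => snd z) (t, x)) by apply continuous_snd.
    apply continuous_Cmult; [|apply continuous_Cmult; [apply continuous_const|]].
    + apply (continuous_comp (fun z : R * R => th * fst z) expi).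
      * apply (continuous_scal_r (V := R_NormedModule) th). exact c1.
      * apply (continuous_ext (fun y => expi (1 * y))); [intro; f_equal; ring|apply cont_expi_lin].
    + apply (continuous_comp (fun z : R * R => INR N * snd z + ka * fst z) (dt_profile j k)).
      * apply (continuous_plus (V := R_NormedModule));
          apply (continuous_scal_r (V := R_NormedModule)); assumption.
      * apply (deriv_cont _ _ (dt_profile_deriv j k)).
  - apply derive_within_of_deriv; [assumption|].
    eapply deriv_eq; [apply (deriv_expi_mul_affine th ka (INR N * x) t (fun y => Cmult (RtoC (INR N ^ k)) (dt_profile j k y))
      (fun y => Cmult (RtoC (INR N ^ k)) (dt_profile j (S k) y)))|reflexivity|].
    + intro y. eapply deriv_eq; [apply deriv_mult; [apply deriv_const|apply dt_profile_deriv]|reflexivity|cbv beta; ring].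
    + unfold travelling_partial. simpl. ring.
  - eapply deriv_eq; [apply deriv_mult; [apply deriv_const|apply deriv_mult; [apply deriv_const|]]|reflexivity|].
    + apply (deriv_comp_affine (dt_profile j k) (INR N) (ka * t)). apply dt_profile_deriv.
    + unfold travelling_partial. simpl pow. rewrite RtoC_mult. cbv beta. ring.
Qed.

Lemma travelling_wave_solution (om : R) (m p : nat) (I : R -> Prop) :
  (p - 1 = 2 * m)%nat -> periodic (Pd 0%nat) ->
  (forall y, Cplus (Cmult (RtoC th) (Pd 0%nat y))
     (Cplus (Cmult (Cmult (Copp Ci) (RtoC ka)) (Pd 1%nat y)) (Cmult (RtoC (INR N ^ 2)) (Pd 2%nat y)))
     = nonlin om m (Pd 0%nat y)) ->
  is_solution om p I (fun t x => Cmult (expi (th * t)) (Pd 0%nat (INR N * x + ka * t))).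
Proof.
  intros Hp Hper Heq. split.
  - intros t x _. f_equal.
    replace (INR N * (x + 2 * PI) + ka * t) with (INR N * x + ka * t + IZR (Z.of_nat N) * (2 * PI)).
    + apply (periodic_Z _ Hper).
    + rewrite <- INR_IZR_INZ. ring.
  - exists travelling_partial. split; [apply travelling_smooth|].
    intros t x _. rewrite Hp, Cmod_mult, Cmod_expi, Rmult_1_l.
    set (y := INR N * x + ka * t). specialize (Heq y). unfold nonlin in Heq.
    transitivity (Cmult (expi (th * t)) (Cmult (RtoC (om * Cmod (Pd 0%nat y) ^ (2 * m))) (Pd 0%nat y))); [|ring].
    rewrite <- Heq. unfold travelling_partial. fold y. simpl dt_profile. rewrite !pow_O.
    replace (Cmult (RtoC th) (Pd 0%nat y)) with (Cmult (Copp (Cmult Ci Ci)) (Cmult (RtoC th) (Pd 0%nat y)))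
      by (apply C_ext; simpl; ring).
    ring.
Qed.

End TravellingWave.

Lemma fast_wave_exists (om : R) (m : nat) (a K : R) : a <> 0 -> K <> 0 ->
  exists (M : R) (N0 : nat), forall N : nat, (N0 <= N)%nat ->
  exists (P : R -> C) (th ka : R),
    cont P /\ periodic P /\ (forall y, Cmod (P y) <= M) /\ mean P = RtoC a /\
    Rabs (th - rate0 om m a K) <= 1 /\
    forall (p : nat) (I : R -> Prop), (p - 1 = 2 * m)%nat ->
      is_solution om p I (fun t x => Cmult (expi (th * t)) (P (INR N * x + ka * t))).
Proof.
  intros Ha HK. destruct (profile_exists om m a K Ha HK) as [M [eps0 [He0 H]]].
  (* The summand 1 gives N > 1, hence N^2 > N > 1 / eps0, which is eps < eps0. *)
  destruct (INR_unbounded (/ eps0 + 1)) as [N0 HN0].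
  exists M, N0. intros N HN.
  assert (HN1 : / eps0 + 1 < INR N) by (apply Rlt_le_trans with (INR N0); [assumption|now apply le_INR]).
  pose proof (Rinv_0_lt_compat _ He0) as Hi.
  assert (HNN : 0 < INR N ^ 2) by (apply pow_lt; lra).
  set (eps := / INR N ^ 2).
  destruct (H eps) as [P [W [tau [gam [HP [HW [Hper [HM [Hmean Htau]]]]]]]]].
  { unfold eps. split; [now apply Rinv_0_lt_compat|].
    rewrite <- (Rinv_inv eps0). apply Rinv_lt_contravar; [now apply Rmult_lt_0_compat|]. nra. }
  set (dW := Eadd (Emul (Econst Ci) EW) (Emul (Econst (Cmult (Copp Ci) (RtoC eps)))
    (Eadd (enonlin om m) (Eadd (Emul (Econst (RtoC (- tau))) EP) (Emul (Econst (RtoC gam)) EW))))).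
  assert (EW' : forall y, eval P W dW y = Cminus (Cmult Ci (W y)) (Cmult (Cmult Ci (RtoC eps))
       (Cplus (nonlin om m (P y)) (Cplus (Cmult (RtoC (- tau)) (P y)) (Cmult (RtoC gam) (W y)))))).
  { intro y. unfold dW. cbn [eval]. rewrite eval_enonlin. ring. }
  destruct (derivative_sequence P W dW HP) as [Pd [HPd Hval]].
  { intro y. rewrite EW'. apply HW. }
  exists (Pd 0%nat), tau, (INR N ^ 2 - gam).
  assert (E0 : forall y, Pd 0%nat y = P y) by (intro; apply Hval).
  split; [exact (deriv_cont _ _ (HPd 0%nat))|split; [|split; [|split; [|split]]]].
  - intro y. rewrite !E0. apply Hper.
  - intro y. rewrite E0. apply HM.
  - rewrite (mean_ext _ P) by assumption. exact Hmean.
  - exact Htau.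
  - intros p I Hp. apply travelling_wave_solution with (m := m); try assumption.
    + intro y. rewrite !E0. apply Hper.
    + intro y. destruct (Hval y) as [V0 [V1 V2]]. rewrite V0, V1, V2, EW'.
      assert (Heps : Cmult (RtoC (INR N ^ 2)) (RtoC eps) = RtoC 1).
      { rewrite <- RtoC_mult. f_equal. unfold eps. apply Rinv_r. lra. }
      set (F := nonlin om m (P y)) in *. rewrite RtoC_minus, RtoC_opp.
      assert (Hi2 : Cmult Ci Ci = RtoC (-1)) by (apply C_ext; simpl; ring).
      assert (Hm1 : RtoC (-1) = Copp (RtoC 1)) by (apply C_ext; simpl; ring).
      (* The products i * i and N^2 * eps are isolated because [ring] knows neither i^2 = -1 nor N^2
         eps = 1. *)
      transitivity (Cplus (Cmult (RtoC tau) (P y)) (Cplus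
        (Cmult (Copp (Cmult Ci Ci)) (Cmult (Cminus (RtoC (INR N ^ 2)) (RtoC gam)) (W y)))
        (Cmult (Cmult Ci Ci) (Cminus (Cmult (RtoC (INR N ^ 2)) (W y)) (Cmult (Cmult (RtoC (INR N ^ 2)) (RtoC eps))
          (Cplus F (Cplus (Cmult (Copp (RtoC tau)) (P y)) (Cmult (RtoC gam) (W y))))))))); [ring|].
      rewrite Heps, Hi2, Hm1. ring.
Qed.

(** * Fourier coefficients and Sobolev norms *)

Lemma fourier_mean (f : R -> C) (n : Z) : fourier f n = mean (fun x => Cmult (f x) (wave (- n) x)).
Proof.
  apply mean_ext. intro x. unfold wave. rewrite opp_IZR. do 2 f_equal. ring.
Qed.

Lemma fourier_zero (f : R -> C) : fourier f 0 = mean f.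
Proof. rewrite fourier_mean. apply mean_ext. intro x. simpl Z.opp. rewrite wave_0. ring. Qed.

Lemma expi_neq_1 (x : R) : 0 < Rabs x < 2 * PI -> expi x <> RtoC 1.
Proof.
  intros Hx E. assert (Hc : cos x = 1) by now apply (f_equal fst) in E.
  assert (Hc2 : cos (Rabs x) = 1) by (unfold Rabs; destruct (Rcase_abs x); [now rewrite cos_neg|assumption]).
  replace (Rabs x) with (2 * (Rabs x / 2)) in Hc2 by field. rewrite cos_2a_sin in Hc2.
  pose proof (sin_gt_0 (Rabs x / 2) ltac:(lra) ltac:(lra)). nra.
Qed.

Lemma mean_shift (f : R -> C) (b : R) : cont f -> periodic f -> mean (fun x => f (x + b)) = mean f.
Proof.
  intros Hf Hp. unfold mean. f_equal.
  rewrite <- (integral_comp_affine f 1 b) by (assumption || lia).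
  apply integral_ext. intro x. simpl INR. now rewrite Rmult_1_l.
Qed.

(** The mean is invariant under shifts, so it equals c times itself. This gives both the
    orthogonality of the waves (shift by half a wavelength, c = -1) and the spectral gap of
    functions of period 2 PI / N. *)
Lemma mean_eigenshift (f : R -> C) (b : R) (c : C) : cont f -> periodic f -> c <> RtoC 1 ->
  (forall x, f (x + b) = Cmult c (f x)) -> mean f = RtoC 0.
Proof.
  intros Hf Hp Hc H. pose proof (mean_shift f b Hf Hp) as E.
  rewrite (mean_ext _ _ H), mean_scal in E by assumption.
  assert (E2 : Cmult (Cminus c (RtoC 1)) (mean f) = RtoC 0).
  { transitivity (Cminus (Cmult c (mean f)) (mean f)); [ring|]. rewrite E. ring. }
  destruct (Ceq_dec (mean f) (RtoC 0)) as [|Hn]; [assumption|exfalso].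
  apply (Cmult_neq_0 (Cminus c (RtoC 1)) (mean f)); try assumption.
  intro E3. apply Hc. replace c with (Cplus (Cminus c (RtoC 1)) (RtoC 1)) by ring. rewrite E3. ring.
Qed.

Lemma mean_wave (n : Z) : n <> 0%Z -> mean (wave n) = RtoC 0.
Proof.
  intro Hn. pose proof PI_RGT_0. assert (Hn' : 0 < Rabs (IZR n)) by (apply Rabs_pos_lt; now apply not_0_IZR).
  destruct (wave_regular n) as [Hc [Hp _]].
  apply mean_eigenshift with (b := PI / IZR n) (c := expi PI); try assumption.
  - apply expi_neq_1. rewrite Rabs_pos_eq; lra.
  - intro x. unfold wave. rewrite <- expi_plus. f_equal. field. intro E. rewrite E, Rabs_R0 in Hn'. lra.
Qed.

(** Under the shift by 2 PI / N the function f(x) e^(-inx) is multiplied by e^(-2 PI i n / N), which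
    is not 1 when 0 < |n| < N. *)
Lemma fourier_gap (f : R -> C) (N : nat) (n : Z) : (0 < N)%nat -> cont f -> periodic f ->
  (forall x, f (x + 2 * PI / INR N) = f x) -> n <> 0%Z -> (Z.abs n < Z.of_nat N)%Z ->
  fourier f n = RtoC 0.
Proof.
  intros HN Hc Hp Hs Hn Hlt. rewrite fourier_mean. pose proof PI_RGT_0.
  assert (HN' : 0 < INR N) by now apply lt_0_INR.
  destruct (wave_regular (- n)) as [Wc [Wp _]].
  apply mean_eigenshift with (b := 2 * PI / INR N) (c := expi (IZR (- n) * (2 * PI / INR N))).
  - now apply cont_mult.
  - intro x. now rewrite Hp, Wp.
  - apply expi_neq_1. rewrite Rabs_mult, <- abs_IZR, Z.abs_opp.
    rewrite (Rabs_pos_eq (2 * PI / INR N)) by (left; apply Rdiv_lt_0_compat; lra).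
    assert (h1 : 0 < IZR (Z.abs n)) by (apply IZR_lt; lia).
    assert (h2 : IZR (Z.abs n) < INR N) by (rewrite INR_IZR_INZ; now apply IZR_lt).
    assert (h3 : 0 < 2 * PI / INR N) by (apply Rdiv_lt_0_compat; lra).
    split; [now apply Rmult_lt_0_compat|].
    replace (2 * PI) with (INR N * (2 * PI / INR N)) at 2 by (field; lra).
    now apply Rmult_lt_compat_r.
  - intro x. rewrite Hs. unfold wave. rewrite Rmult_plus_distr_l, expi_plus. ring.
Qed.

Definition energy (f : R -> C) : R := fst (mean (fun x => Cmult (f x) (Cconj (f x)))).

Lemma energy_nonneg (f : R -> C) : cont f -> 0 <= energy f.
Proof.
  intro Hf. apply mean_Re_nonneg; [apply cont_mult; [assumption|now apply cont_conj]|].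
  intro y. rewrite <- Cmod2_conj. simpl. pose proof (Cmod_ge_0 (f y)). nra.
Qed.

Lemma energy_le (f : R -> C) (M : R) : cont f -> (forall x, Cmod (f x) <= M) -> energy f <= M ^ 2.
Proof.
  intros Hf HM. eapply Rle_trans; [apply Rle_abs|].
  assert (B : Cmod (mean (fun x => Cmult (f x) (Cconj (f x)))) <= M ^ 2).
  { apply mean_norm_le; [apply cont_mult; [assumption|now apply cont_conj]|].
    intro x. rewrite Cmod_mult, Cmod_conj. pose proof (Cmod_ge_0 (f x)). specialize (HM x). nra. }
  eapply Rle_trans; [|exact B]. eapply Rle_trans; [apply Rmax_l|apply Rmax_Cmod].
Qed.

Definition remove_mode (f : R -> C) (n : Z) (x : R) : C := Cminus (f x) (Cmult (fourier f n) (wave n x)).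

Lemma remove_mode_cont (f : R -> C) (n : Z) : cont f -> cont (remove_mode f n).
Proof.
  intro Hf. apply cont_minus; [assumption|]. apply cont_mult; [apply cont_const|apply wave_regular].
Qed.

Lemma fourier_remove_mode (f : R -> C) (n k : Z) : cont f -> n <> k ->
  fourier (remove_mode f n) k = fourier f k.
Proof.
  intros Hf Hnk. rewrite (fourier_mean (remove_mode f n) k), (fourier_mean f k).
  rewrite (mean_ext _ (fun x => Cminus (Cmult (f x) (wave (- k) x)) (Cmult (fourier f n) (wave (n + - k) x)))).
  2: { intro x. rewrite <- wave_mul. unfold remove_mode. ring. }
  rewrite mean_minus, mean_scal, mean_wave.
  - ring.
  - lia.
  - apply wave_regular.
  - apply cont_mult; [assumption|apply wave_regular].
  - apply cont_mult; [apply cont_const|apply wave_regular].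
Qed.

Lemma wave_conj (n : Z) (x : R) : Cconj (wave n x) = wave (- n) x.
Proof. unfold wave. rewrite <- expi_neg, opp_IZR. f_equal. ring. Qed.

Lemma mean_conj (f : R -> C) : cont f -> mean (fun x => Cconj (f x)) = Cconj (mean f).
Proof.
  intro Hf. unfold mean.
  rewrite (integral_deriv (fun y => Cconj (integral f 0 y))).
  - rewrite integral_point. apply C_ext; simpl; ring.
  - intro x. apply deriv_conj. now apply primitive_deriv.
  - now apply cont_conj.
Qed.

(** Pythagoras: in the expansion of |f - c e^(inx)|^2 each of the two cross terms has mean |c|^2,
    because c is the coefficient of f. *)
Lemma energy_remove_mode (f : R -> C) (n : Z) : cont f ->
  energy f = Cmod (fourier f n) ^ 2 + energy (remove_mode f n).
Proof.
  intro Hf. unfold energy. set (c := fourier f n).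
  rewrite (mean_ext (fun x => Cmult (remove_mode f n x) (Cconj (remove_mode f n x)))
    (fun x => Cminus (Cplus (Cmult (f x) (Cconj (f x))) (Cmult c (Cconj c)))
       (Cplus (Cmult (Cconj c) (Cmult (f x) (wave (- n) x))) (Cmult c (Cconj (Cmult (f x) (wave (- n) x))))))).
  2: { intro x. unfold remove_mode. fold c.
       rewrite Cmult_conj, <- wave_conj, Cconj_conj, Cminus_conj, Cmult_conj.
       transitivity (Cminus (Cplus (Cmult (f x) (Cconj (f x))) (Cmult (Cmult c (Cconj c)) (Cmult (wave n x) (Cconj (wave n x)))))
         (Cplus (Cmult (Cconj c) (Cmult (f x) (Cconj (wave n x)))) (Cmult c (Cmult (Cconj (f x)) (wave n x))))); [ring|].
       rewrite wave_conj, wave_mul, Z.add_opp_diag_r, wave_0. ring. }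
  assert (c1 : cont (fun x => Cmult (f x) (wave (- n) x))) by (apply cont_mult; [assumption|apply wave_regular]).
  assert (c2 : cont (fun x => Cconj (Cmult (f x) (wave (- n) x)))) by now apply cont_conj.
  assert (c3 : cont (fun x => Cmult (f x) (Cconj (f x)))) by (apply cont_mult; [assumption|now apply cont_conj]).
  rewrite mean_minus, mean_plus, mean_const, mean_plus, !mean_scal, mean_conj by
    (assumption || apply cont_const || (apply cont_plus; (assumption || apply cont_const || (apply cont_mult; [apply cont_const|assumption])))
     || (apply cont_mult; [apply cont_const|assumption])).
  rewrite <- fourier_mean. fold c.
  replace (Cmod c ^ 2) with (fst (Cmult c (Cconj c))) by (rewrite <- Cmod2_conj; reflexivity).
  simpl. ring.
Qed.

(** The newest pair of modes is split off and the induction hypothesis is applied to the remainder,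
    whose other coefficients are unchanged; hence the induction over all f. The pairing k, -(k + 1)
    is that of [Zsum]. *)
Lemma bessel (n : nat) (f : R -> C) : cont f ->
  sum_n (fun k => Cmod (fourier f (Z.of_nat k)) ^ 2 + Cmod (fourier f (- Z.of_nat (S k))) ^ 2) n <= energy f.
Proof.
  revert f. induction n as [|n IH]; intros f Hf.
  - rewrite sum_O.
    rewrite (energy_remove_mode f (Z.of_nat 0) Hf).
    rewrite (energy_remove_mode _ (- Z.of_nat 1) (remove_mode_cont f _ Hf)).
    rewrite fourier_remove_mode by (assumption || lia).
    pose proof (energy_nonneg _ (remove_mode_cont _ (- Z.of_nat 1) (remove_mode_cont f (Z.of_nat 0) Hf))). lra.
  - rewrite sum_Sn.
    rewrite (energy_remove_mode f (Z.of_nat (S n)) Hf).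
    rewrite (energy_remove_mode _ (- Z.of_nat (S (S n))) (remove_mode_cont f _ Hf)).
    rewrite fourier_remove_mode by (assumption || lia).
    pose proof (IH _ (remove_mode_cont _ (- Z.of_nat (S (S n))) (remove_mode_cont f (Z.of_nat (S n)) Hf))) as H.
    erewrite sum_n_ext_loc in H.
    2: { intros k Hk. rewrite !fourier_remove_mode by (try apply remove_mode_cont; (assumption || lia)). reflexivity. }
    unfold plus; simpl plus. simpl in *. lra.
Qed.

(** The weight has to be bounded only on the spectrum of f; Bessel's inequality then controls the
    sum by w M^2. *)
Lemma Hs_norm_bound (s w M : R) (f : R -> C) : cont f -> (forall x, Cmod (f x) <= M) -> 0 <= w ->
  (forall n, fourier f n <> RtoC 0 -> Rpower (1 + Rabs (IZR n)) (2 * s) <= w) ->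
  Rbar_le (Hs_norm s f) (sqrt w * M).
Proof.
  intros Hf HM Hw Hn.
  assert (M0 : 0 <= M) by (eapply Rle_trans; [apply Cmod_ge_0|apply (HM 0)]).
  assert (T : forall n, 0 <= Rpower (1 + Rabs (IZR n)) (2 * s) * Cmod (fourier f n) ^ 2 <= w * Cmod (fourier f n) ^ 2).
  { intro n. pose proof (pow2_ge_0 (Cmod (fourier f n))). split.
    - apply Rmult_le_pos; [left; apply exp_pos|assumption].
    - destruct (Ceq_dec (fourier f n) (RtoC 0)) as [E|E].
      + rewrite E, Cmod_0. simpl. lra.
      + apply Rmult_le_compat_r; auto. }
  set (L := Zsum (fun n => Rpower (1 + Rabs (IZR n)) (2 * s) * Cmod (fourier f n) ^ 2)).
  (* The two bounds also exclude infinite values of [L], so the square root is the real one. *)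
  assert (HL : Rbar_le 0 L /\ Rbar_le L (w * M ^ 2)).
  { unfold L, Zsum. split.
    - rewrite <- (Lim_seq_const 0). apply Lim_seq_le_loc. exists 0%nat. intros n _.
      replace 0 with (sum_n (fun _ => 0) n) by (rewrite sum_n_const; apply Rmult_0_r). apply sum_n_m_le. intro k.
      pose proof (T (Z.of_nat k)). pose proof (T (- Z.of_nat (S k))%Z). lra.
    - rewrite <- (Lim_seq_const (w * M ^ 2)). apply Lim_seq_le_loc. exists 0%nat. intros n _.
      apply Rle_trans with (w * sum_n (fun k => Cmod (fourier f (Z.of_nat k)) ^ 2 + Cmod (fourier f (- Z.of_nat (S k))) ^ 2) n).
      + rewrite <- (sum_n_mult_l (K := R_Ring)). apply sum_n_m_le. intro k. unfold mult; simpl mult.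
        pose proof (T (Z.of_nat k)). pose proof (T (- Z.of_nat (S k))%Z). simpl in *. lra.
      + apply Rmult_le_compat_l; [assumption|].
        eapply Rle_trans; [now apply bessel|now apply energy_le]. }
  unfold Hs_norm. fold L. destruct HL as [L1 L2]. destruct L as [r| |]; simpl in *; try easy.
  rewrite <- (sqrt_pow2 M M0), <- sqrt_mult by (simpl; nra). now apply sqrt_le_1_alt.
Qed.

(** * The instability *)

Lemma Rpower_neg_antitone (x y e : R) : e <= 0 -> 0 < x -> x <= y -> Rpower y e <= Rpower x e.
Proof.
  intros He Hx Hxy. unfold Rpower.
  assert (H : ln x <= ln y) by (destruct Hxy as [Hlt|<-]; [left; now apply ln_increasing|right; reflexivity]).
  assert (H2 : e * ln y <= e * ln x) by nra.
  destruct H2 as [Hlt|E]; [left; now apply exp_increasing|right; now rewrite E].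
Qed.

Lemma Rpower_neg_small (e eta : R) : e < 0 -> 0 < eta ->
  exists N0 : nat, forall N : nat, (N0 <= N)%nat -> Rpower (1 + INR N) e < eta.
Proof.
  intros He Heta. destruct (INR_unbounded (exp (ln eta / e))) as [N0 HN0].
  exists N0. intros N HN. apply le_INR in HN. pose proof (exp_pos (ln eta / e)).
  unfold Rpower. apply Rlt_le_trans with (exp (ln eta)); [|rewrite exp_ln by assumption; apply Rle_refl].
  apply exp_increasing.
  assert (Hl : ln eta / e < ln (1 + INR N)).
  { rewrite <- (ln_exp (ln eta / e)). apply ln_increasing; [assumption|lra]. }
  replace (ln eta) with (e * (ln eta / e)) by (field; lra). nra.
Qed.

Lemma Cmod_expi_antipodal (x y : R) : Rabs (y - x) = PI -> Cmod (Cminus (expi x) (expi y)) = 2.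
Proof.
  intro H.
  replace (expi y) with (Copp (expi x)).
  - replace (Cminus (expi x) (Copp (expi x))) with (Cmult (RtoC 2) (expi x)) by (apply C_ext; simpl; ring).
    rewrite Cmod_mult, Cmod_expi, Cmod_R, Rabs_pos_eq; lra.
  - replace y with (x + (y - x)) by ring. rewrite expi_plus.
    assert (E : expi (y - x) = RtoC (-1)).
    { unfold Rabs in H. unfold expi. destruct (Rcase_abs (y - x)).
      - replace (y - x) with (- PI) by lra. now rewrite cos_neg, sin_neg, cos_PI, sin_PI, Ropp_0.
      - rewrite H. now rewrite cos_PI, sin_PI. }
    rewrite E. apply C_ext; simpl; ring.
Qed.

Lemma cont_comp_affine (P : R -> C) (a b : R) : cont P -> cont (fun x => P (a * x + b)).
Proof.
  intros HP x. apply (continuous_comp (fun x => a * x + b) P); [|apply HP].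
  apply (ex_derive_continuous (fun x : R => a * x + b)). auto_derive. trivial.
Qed.

Lemma fourier_zero_travelling (P : R -> C) (N : nat) (th ka t : R) : (0 < N)%nat -> cont P -> periodic P ->
  fourier (fun x => Cmult (expi (th * t)) (P (INR N * x + ka * t))) 0 = Cmult (expi (th * t)) (mean P).
Proof.
  intros HN HP Hp. rewrite fourier_zero, mean_scal by now apply cont_comp_affine.
  f_equal. unfold mean. f_equal. now apply integral_comp_affine.
Qed.

Lemma constant_solution (om a : R) (m p : nat) (I : R -> Prop) : 0 < a -> (p - 1 = 2 * m)%nat ->
  is_solution om p I (fun t x => Cmult (expi (om * a ^ (2 * m) * t)) (RtoC a)).
Proof.
  intros Ha Hp.
  (* The plane wave is the travelling wave with constant profile, zero drift and N = 1. *)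
  apply (travelling_wave_solution (fun n _ => match n with O => RtoC a | S _ => RtoC 0 end) _ 0 1)
    with (m := m); try assumption.
  - intros [|n] y; apply deriv_const.
  - intro y. reflexivity.
  - intro y. unfold nonlin. rewrite Cmod_R, Rabs_pos_eq by lra. ring.
Qed.

Lemma rate_gap (om : R) (k : nat) (a D : R) : om = 1 \/ om = -1 -> 0 < a -> 0 < D ->
  exists K, 0 < K /\ D <= Rabs (rate0 om (S k) a K - om * a ^ (2 * S k)).
Proof.
  intros Hom Ha HD. pose proof (pow_lt (a ^ 2) k ltac:(nra)) as Hk.
  (* By the tangent inequality (a^2 + K^2)^(k+1) exceeds a^(2k+2) by at least (k + 1) a^(2k) K^2,
     and this K makes that (k + 1) D >= D. *)
  exists (sqrt (D / (a ^ 2) ^ k)).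
  assert (HDk : 0 < D / (a ^ 2) ^ k) by now apply Rdiv_lt_0_compat.
  split; [now apply sqrt_lt_R0|].
  set (K := sqrt (D / (a ^ 2) ^ k)).
  assert (HK : 0 < K) by now apply sqrt_lt_R0.
  assert (HK2 : K ^ 2 = D / (a ^ 2) ^ k) by (apply pow2_sqrt; lra).
  pose proof (rate0_lower_bound om k a K Hom Ha HK) as H1.
  pose proof (pow_tangent_le (a ^ 2) (K ^ 2) k ltac:(nra) ltac:(nra)) as H2.
  assert (H3 : D <= INR (S k) * (a ^ 2) ^ k * K ^ 2).
  { rewrite HK2. replace (INR (S k) * (a ^ 2) ^ k * (D / (a ^ 2) ^ k)) with (INR (S k) * D) by (field; lra).
    rewrite S_INR. pose proof (pos_INR k). nra. }
  rewrite pow_mult.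
  replace (Rabs (rate0 om (S k) a K - om * (a ^ 2) ^ S k)) with (Rabs (om * rate0 om (S k) a K - (a ^ 2) ^ S k)).
  - eapply Rle_trans; [|apply Rle_abs]. lra.
  - replace (om * rate0 om (S k) a K - (a ^ 2) ^ S k) with (om * (rate0 om (S k) a K - om * (a ^ 2) ^ S k))
      by (destruct Hom; subst; ring).
    rewrite Rabs_mult. replace (Rabs om) with 1; [ring|].
    destruct Hom; subst; [now rewrite Rabs_R1|rewrite Rabs_left; lra].
Qed.

Lemma Hs_norm_constant (s a : R) : s < 0 -> 0 < a -> Rbar_le (Hs_norm s (fun _ => RtoC a)) a.
Proof.
  intros Hs Ha.
  replace (Finite a) with (Finite (sqrt 1 * a)) by (rewrite sqrt_1, Rmult_1_l; reflexivity).
  apply Hs_norm_bound; [apply cont_const| |lra|].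
  - intro x. rewrite Cmod_R, Rabs_pos_eq; lra.
  - intros n _. pose proof (Rabs_pos (IZR n)).
    apply Rle_trans with (Rpower (1 + Rabs (IZR n)) 0); [apply Rle_Rpower; lra|].
    rewrite Rpower_O; lra.
Qed.

Lemma Hs_norm_fast_wave (s a M : R) (P : R -> C) (N : nat) : s < 0 -> 0 < a -> (0 < N)%nat ->
  cont P -> periodic P -> (forall y, Cmod (P y) <= M) -> mean P = RtoC a ->
  Rbar_le (Hs_norm s (fun x => Cminus (RtoC a) (P (INR N * x + 0)))) (sqrt (Rpower (1 + INR N) (2 * s)) * (a + M)).
Proof.
  intros Hs Ha HN Hc Hp HM Hmean.
  assert (HN' : 0 < INR N) by now apply lt_0_INR.
  assert (Hf : cont (fun x => Cminus (RtoC a) (P (INR N * x + 0))))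
    by (apply cont_minus; [apply cont_const|now apply cont_comp_affine]).
  apply Hs_norm_bound; [assumption| |left; apply exp_pos|].
  - intro x. eapply Rle_trans; [apply Cmod_triangle|]. rewrite Cmod_opp, Cmod_R, Rabs_pos_eq by lra.
    specialize (HM (INR N * x + 0)). lra.
  - intros n Hn. destruct (Z_lt_le_dec (Z.abs n) (Z.of_nat N)) as [Hlt|Hle].
    + exfalso. apply Hn. destruct (Z.eq_dec n 0) as [->|Hn0].
      * rewrite fourier_zero, mean_minus, mean_const by (apply cont_const || now apply cont_comp_affine).
        replace (mean (fun x => P (INR N * x + 0))) with (mean P); [rewrite Hmean; ring|].
        unfold mean. f_equal. symmetry. now apply integral_comp_affine.
      * apply (fourier_gap _ N); try assumption.
        -- intro x. f_equal.
           replace (INR N * (x + 2 * PI) + 0) with (INR N * x + 0 + IZR (Z.of_nat N) * (2 * PI))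
             by (rewrite <- INR_IZR_INZ; ring).
           apply (periodic_Z _ Hp).
        -- intro x. f_equal.
           replace (INR N * (x + 2 * PI / INR N) + 0) with (INR N * x + 0 + 2 * PI) by (field; lra). apply Hp.
    + apply Rpower_neg_antitone; [lra|lra|].
      rewrite <- abs_IZR, INR_IZR_INZ. apply IZR_le in Hle. lra.
Qed.

Lemma Hs_norm_ext (s : R) (f g : R -> C) : (forall x, f x = g x) -> Hs_norm s f = Hs_norm s g.
Proof.
  intro E. assert (Ef : forall n, fourier f n = fourier g n).
  { intro n. rewrite !fourier_mean. apply mean_ext. intro. now rewrite E. }
  unfold Hs_norm, Zsum. apply f_equal, Lim_seq_ext. intro n. apply sum_n_ext. intro k. now rewrite !Ef.
Qed.

Theorem theorem1 :
  forall s : R, s < 0 ->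
  exists c : R, 0 < c /\
  forall (omega : R) (p : nat),
    (omega = 1 \/ omega = -1) -> (3 <= p)%nat -> Nat.Odd p ->
  forall rho : R, 0 < rho ->
  exists u : R -> R -> C,
    is_solution omega p (fun t => 0 <= t) u /\
    Rbar_le (Hs_norm s (u 0)) rho /\
    forall delta : R, 0 < delta ->
    exists v : R -> R -> C,
      is_solution omega p (fun t => 0 <= t <= delta) v /\
      Rbar_lt (Hs_norm s (fun x => Cminus (u 0 x) (v 0 x))) delta /\
      Rbar_lt (c * rho)
        (Lub_Rbar (fun y : R => exists t : R, 0 <= t <= delta /\
           y = Cmod (Cminus (fourier (u t) 0%Z) (fourier (v t) 0%Z)))).
Proof.
  (* The means become antipodal on the circle of radius rho, at distance 2 rho, so c = 1 leaves room
     for the strict inequality. *)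
  intros s Hs. exists 1. split; [lra|].
  intros om p Hom Hp3 [m Hm] rho Hrho.
  assert (Hp : (p - 1 = 2 * m)%nat) by lia.
  (* p >= 3 excludes m = 0, the linear equation, in which the rotation rate does not depend on the
     amplitude. *)
  destruct m as [|k]; [lia|].
  set (th0 := om * rho ^ (2 * S k)).
  exists (fun t x => Cmult (expi (th0 * t)) (RtoC rho)).
  split; [now apply constant_solution|split].
  - rewrite (Hs_norm_ext s _ (fun _ => RtoC rho)); [now apply Hs_norm_constant|].
    intro x. rewrite Rmult_0_r, expi_0. ring.
  - intros delta Hd. pose proof PI_RGT_0 as HPI.
    assert (Hpd : 0 < PI / delta) by now apply Rdiv_lt_0_compat.
    (* The extra 1 absorbs the error |theta - [rate0]| <= 1 of the exact wave. *)
    destruct (rate_gap om k rho (1 + PI / delta) Hom Hrho ltac:(lra)) as [K [HK Hgap]].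
    destruct (fast_wave_exists om (S k) rho K ltac:(lra) ltac:(lra)) as [M [N1 HN1]].
    set (B := Rabs (rho + M) + 1).
    assert (HB : 0 < B) by (unfold B; pose proof (Rabs_pos (rho + M)); lra).
    destruct (Rpower_neg_small (2 * s) ((delta / B) ^ 2) ltac:(lra)) as [N2 HN2].
    { apply pow_lt. now apply Rdiv_lt_0_compat. }
    set (N := (S (N1 + N2))%nat).
    destruct (HN1 N ltac:(lia)) as [P [th [ka [Pc [Pp [PM [Pmean [Hth Hsol]]]]]]]].
    specialize (HN2 N ltac:(lia)).
    exists (fun t x => Cmult (expi (th * t)) (P (INR N * x + ka * t))).
    split; [now apply Hsol|split].
    + rewrite (Hs_norm_ext s _ (fun x => Cminus (RtoC rho) (P (INR N * x + 0)))).
      2: { intro x. rewrite !Rmult_0_r, expi_0. ring. }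
      eapply Rbar_le_lt_trans; [apply (Hs_norm_fast_wave s rho M); try assumption; lia|].
      simpl Rbar_lt.
      assert (Hsq : sqrt (Rpower (1 + INR N) (2 * s)) < delta / B).
      { rewrite <- (sqrt_pow2 (delta / B)) by (left; now apply Rdiv_lt_0_compat).
        apply sqrt_lt_1_alt. split; [left; apply exp_pos|assumption]. }
      pose proof (sqrt_pos (Rpower (1 + INR N) (2 * s))).
      apply Rle_lt_trans with (sqrt (Rpower (1 + INR N) (2 * s)) * B).
      * apply Rmult_le_compat_l; [assumption|]. unfold B. pose proof (Rle_abs (rho + M)). lra.
      * replace delta with (delta / B * B) at 1 by (field; lra). now apply Rmult_lt_compat_r.
    + set (G := Rabs (th - th0)).
      assert (HG : PI / delta <= G).
      { unfold G. fold th0 in Hgap.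
        pose proof (Rabs_triang (th - th0) (rate0 om (S k) rho K - th)) as Ht.
        replace (th - th0 + (rate0 om (S k) rho K - th)) with (rate0 om (S k) rho K - th0) in Ht by ring.
        rewrite (Rabs_minus_sym (rate0 _ _ _ _) th) in Ht. lra. }
      assert (HG0 : 0 < G) by lra.
      (* The supremum is bounded below by the value at time PI / G, which is at most delta and at
         which the two phases differ by exactly PI. *)
      eapply Rbar_lt_le_trans; [|apply (proj1 (Lub_Rbar_correct _)); exists (PI / G); split; [|reflexivity]].
      * rewrite (fourier_zero_travelling P N) by (assumption || lia).
        rewrite fourier_zero, mean_const, Pmean.
        replace (Cminus (Cmult (expi (th0 * (PI / G))) (RtoC rho)) (Cmult (expi (th * (PI / G))) (RtoC rho)))
          with (Cmult (RtoC rho) (Cminus (expi (th0 * (PI / G))) (expi (th * (PI / G))))) by ring.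
        rewrite Cmod_mult, Cmod_R, Rabs_pos_eq, Cmod_expi_antipodal by
          (lra || (rewrite <- Rmult_minus_distr_r, Rabs_mult; fold G;
             rewrite Rabs_pos_eq by (left; now apply Rdiv_lt_0_compat); field; lra)).
        simpl. lra.
      * split; [left; now apply Rdiv_lt_0_compat|].
        apply Rmult_le_reg_r with G; [assumption|].
        replace (PI / G * G) with (PI / delta * delta) by (field; lra).
        rewrite (Rmult_comm delta). apply Rmult_le_compat_r; lra.
Qed.
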